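(* Let $G=\mathbb{R}$ or $G=\mathbb{R}_+$, $k\in(0,1)$, and let $E$ be an ideal semi shift-invariant lattice on $G$, with associated space $E^1$, such that $$(\cdot)^{-k}\chi_{(0,1)}(\cdot)\in E^1\quad\text{and}\quad\lim_{h\to0^+}\left\|(\cdot)^{-k}\chi_{(0,h)}(\cdot)\right\|_{E^1}=0.$$ For $h>0$ let $\tau_h(x)=x^{-k}-h^{-k}$ for $x\in(0,h)$ and $\tau_h(x)=0$ for $x\in G\setminus(0,h)$. Then for every $f\in L^1_{\infty,E}(G)$ and $h>0$, there holds the sharp inequality $$\left\|D^k_-f\right\|_{L_\infty(G)}\leqslant\frac{2h^{-k}}{\Gamma(1-k)}\,\|f\|_{L_\infty(G)}+\frac{\|\tau_h\|_{E^1}}{\Gamma(1-k)}\,\|f'\|_E.$$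
   Context: $\mathbb{R}_+=[0,+\infty)$; $\chi_B$ is the indicator function of $B$. An ideal lattice on $G$ is a linear space $E$ of measurable functions $G\to\mathbb{R}$ with a norm $\|\cdot\|_E$ such that if $f\in E$, $g$ is measurable and $|g|\leqslant|f|$ a.e. on $G$, then $g\in E$ and $\|g\|_E\leqslant\|f\|_E$. It is semi shift-invariant if for every $f\in E$ and $x\in G$ we have $f(\cdot+x)\in E$ and $\|f(\cdot+x)\|_E=\|f\|_E$ if $G=\mathbb{R}$, respectively $\|f(\cdot+x)\|_E\leqslant\|f\|_E$ if $G=\mathbb{R}_+$. The support $A(E)\subset G$ of $E$ is the set such that $f(x)=0$ for every $f\in E$, $x\notin A(E)$. The associated space $E^1$ consists of measurable $g$ with $\mathrm{supp}\,g\subset A(E)$ and $\|g\|_{E^1}:=\sup\{\int_G f(x)g(x)\,dx: f\in E,\ \|f\|_E\leqslant1\}<\infty$. $L^1_{\infty,E}(G)$ is the space of $f\in L_\infty(G)$ that are locally absolutely continuous on $G$ with $f'\in E$. Marchaud derivative: for $k>0$, $k\notin\mathbb{N}$, $f:G\to\mathbb{R}$, $x\in G$, $D^k_-f(x)=\frac{1}{\varkappa(k,n)}\int_0^{+\infty}\frac{(\Delta^n_{-t}f)(x)}{t^{1+k}}\,dt$, where $n\in\mathbb{N}$, $n>k$ (the definition does not depend on $n$), $(\Delta^n_{-t}f)(x)=\sum_{m=0}^n(-1)^m\binom{n}{m}f(x+mt)$ and $\varkappa(k,n)=\Gamma(-k)\sum_{m=0}^n(-1)^m\binom{n}{m}m^k$.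 An inequality $\|D^k_-f\|_{L_\infty(G)}\leqslant A\|f\|_{L_\infty(G)}+B\|f'\|_E$ is called sharp here in the sense that for every sufficiently small $\varepsilon>0$ there is $f_\varepsilon\in L^1_{\infty,E}(G)$ with $\|D^k_-f_\varepsilon\|_{L_\infty(G)}>A\|f_\varepsilon\|_{L_\infty(G)}+(B-\varepsilon)\|f_\varepsilon'\|_E$. *)

(* Defs.v *)
From HB Require Import structures.
From mathcomp Require Import all_boot all_order all_algebra.
From mathcomp Require Import all_classical all_reals all_analysis.

Set Implicit Arguments.
Unset Strict Implicit.
Unset Printing Implicit Defensive.

Import Order.TTheory GRing.Theory Num.Theory.
Import numFieldNormedType.Exports.

Local Open Scope classical_set_scope.
Local Open Scope ring_scope.

(* A function on G is represented by a total function R -> R (or R -> \bar R)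
   of which only the values on G matter: measurability is [measurable_fun G],
   and relations between functions are required almost everywhere on G.
   Measurable means Borel measurable; up to a.e. equality these are all the
   Lebesgue measurable functions. *)

Section ideal_lattices.
Context {R : realType}.
Notation mu := (@lebesgue_measure R).
Implicit Types (G A : set R) (E : set (R -> R)) (N : (R -> R) -> R).

(* E is the space and N its norm; N is unconstrained outside E. As usual,
   functions equal a.e. on G are identified, so N f = 0 forces f = 0 a.e. *)
Record ideal_lattice G E N : Prop := IdealLattice {
  il_measurable : forall f, E f -> measurable_fun G f ;
  il_0 : E (cst 0) ;
  il_add : forall f g, E f -> E g -> E (fun x => f x + g x) ;
  il_scale : forall (c : R) f, E f -> E (fun x => c * f x) ;
  il_norm_ge0 : forall f, E f -> 0 <= N f ;
  il_norm_eq0 : forall f, E f -> N f = 0 -> ae_eq mu G f (cst 0) ;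
  il_norm_scale : forall (c : R) f, E f -> N (fun x => c * f x) = `|c| * N f ;
  il_norm_add :
    forall f g, E f -> E g -> N (fun x => f x + g x) <= N f + N g ;
  il_ideal : forall f g : R -> R, E f -> measurable_fun G g ->
    {ae mu, forall x, G x -> `|g x| <= `|f x|} -> E g /\ N g <= N f }.

Definition semi_shift_invariant G E N : Prop :=
  forall f x, E f -> G x ->
    [/\ E (fun y => f (y + x)),
        G = [set: R] -> N (fun y => f (y + x)) = N f &
        G = [set` `[0, +oo[] -> N (fun y => f (y + x)) <= N f].

(* A is the support of E: every function of E vanishes a.e. outside A, and A
   is the smallest such set, up to a null set. *)
Definition is_support G E A : Prop :=
  let carries B := [/\ measurable B, B `<=` G &
    forall f, E f -> {ae mu, forall x, G x -> ~ B x -> f x = 0}] in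
  carries A /\ forall B, carries B -> mu (A `\` B) = 0%E.

(* If f * g has no integral over G, the library integral is -oo; such f do not
   affect the supremum, since replacing f by |f| sgn g gives the value +oo. *)
Definition assoc_norm G E N (g : R -> R) : \bar R :=
  ereal_sup [set (\int[mu]_(x in G) (f x * g x)%:E)%E
            | f in [set f | E f /\ N f <= 1]].

Definition assoc_space G E N A : set (R -> R) :=
  [set g : R -> R | [/\ measurable_fun G g,
               {ae mu, forall x : R, G x -> ~ A x -> g x = 0} &
               (assoc_norm G E N g < +oo)%E]].

Definition Linfty_norm G (f : R -> \bar R) : \bar R :=
  ('N[mu]_+oo[f \_ G])%E.

Definition abs_continuous (a b : R) (f : R -> R) : Prop :=
  forall e, 0 < e -> exists2 d, 0 < d &
    forall (n : nat) (u v : 'I_n -> R),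
      (forall i, a <= u i /\ u i <= v i /\ v i <= b) ->
      trivIset [set: 'I_n] (fun i => [set` `]u i, v i[]) ->
      \sum_(i < n) (v i - u i) < d ->
      \sum_(i < n) `|f (v i) - f (u i)| < e.

Definition locally_abs_continuous G (f : R -> R) : Prop :=
  forall a b, a <= b -> [set` `[a, b]] `<=` G -> abs_continuous a b f.

(* f belongs to L^1_{oo,E}(G) and f' = df. The derivative exists only a.e., so
   it enters through an arbitrary representative df in E; by the ideal property
   N df does not depend on the representative. *)
Definition L1infty G E (f df : R -> R) : Prop :=
  [/\ measurable_fun G f,
      (Linfty_norm G (EFin \o f) < +oo)%E,
      locally_abs_continuous G f,
      E df &
      {ae mu, forall x, G x -> is_derive x 1 f (df x)}].

End ideal_lattices.

Section marchaud.
Context {R : realType}.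
Notation mu := (@lebesgue_measure R).

(* Euler's integral for x > 0, where the number m of factors is 0; continued
   to negative non-integers by
   Gamma(x) = Gamma(x + m) / (x (x + 1) ... (x + m - 1)). *)
Definition Gamma (x : R) : R :=
  let m := Num.truncn (1 - x) in
  (\int[mu]_(t in [set` `]0%R, +oo[]) (t `^ (x + m%:R - 1) * expR (- t)))
    / \prod_(i < m) (x + i%:R).

Definition fwd_diff (n : nat) (t : R) (f : R -> R) (x : R) : R :=
  \sum_(m < n.+1) (-1) ^+ m * 'C(n, m)%:R * f (x + m%:R * t).

Definition varkappa (k : R) (n : nat) : R :=
  Gamma (- k) * \sum_(m < n.+1) (-1) ^+ m * 'C(n, m)%:R * m%:R `^ k.

(* Extended-real valued: a non-convergent integral yields an infinite value,
   so a finite bound on the norm includes convergence a.e. *)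
Definition marchaud (k : R) (n : nat) (f : R -> R) (x : R) : \bar R :=
  (((varkappa k n)^-1)%:E *
   \int[mu]_(t in [set` `]0%R, +oo[]) (fwd_diff n t f x / t `^ (1 + k))%:E)%E.

Definition tau (k h x : R) : R :=
  if x \in `]0, h[ then x `^ (- k) - h `^ (- k) else 0.

Definition cut_power (k h x : R) : R := x `^ (- k) * \1_[set` `]0, h[] x.

End marchaud.

(* Main.v *)
(* Since sum_m (-1)^m 'C(n, m) = 0, rescaling each term of the n-th difference
   reduces the Marchaud derivative to
     k / Gamma (1 - k) * \int_0^oo (f x - f (x + t)) t^(-1-k) dt.
   For t > h the increment is at most 2 ||f||_oo; for t < h it is at most
   \int_0^t |f' (x + s)| ds, and by Tonelli this part of the integral becomes the
   pairing of |f' (x + .)| with tau_h / k.  For sharpness, take f = c - \int_0^x g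
   with g >= 0 supported in ]0, h[ and nearly optimal for ||tau_h||_(E^1), and
   2 c = \int g: then f decreases from ||f||_oo to - ||f||_oo on [0, h], and both
   estimates are nearly equalities at x = 0. *)

Require Import Defs.
From HB Require Import structures.
From mathcomp Require Import all_boot all_order all_algebra.
From mathcomp Require Import all_classical all_reals all_analysis.
From mathcomp Require Import measurable_realfun ess_sup_inf.
From mathcomp Require Import ring lra.

Set Implicit Arguments.
Unset Strict Implicit.
Unset Printing Implicit Defensive.

Import Order.TTheory GRing.Theory Num.Theory.
Import numFieldNormedType.Exports.

Local Open Scope classical_set_scope.
Local Open Scope ring_scope.

(** * Affine changes of variables *)

Section affine_change_of_variables.
Context {R : realType}.
Notation mu := (@lebesgue_measure R).

(** The constants carry no [k]: both \int_s^h t^(-k-1) dt = (s^-k - h^-k) / k and \int_h^oo t^(-k-1)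
    dt = h^-k / k bring a factor 1 / k, which cancels the [k] in k / Gamma (1 - k). All integrals
    are extended-valued and [Gamma] is defined through [fine], so convergence has to be established
    before the reduction of the Marchaud derivative to a first difference; the upper bound is
    therefore proved for the integral of absolute values. That reduction also divides by the
    binomial sum in [varkappa], whose nonvanishing needs a proof. The function f is only known to be
    locally absolutely continuous with an a.e. derivative. The increment bound |f b - f a| <= \int
    |f'| is obtained directly, by an argument along the interval, without writing f as the integral
    of f'. The hypothesis controls x^-k on ]0, 1[ only, whereas h is arbitrary; shifts by 1 bridge
    the gap. For sharpness the norm of [tau] must be positive as well as finite, so that small
    values of e leave a nonnegative coefficient in front of the norm of f'. *)

Let affine (c b x : measurableTypeR R) : measurableTypeR R := c * x + b.

Let measurable_affine c b : measurable_fun [set: measurableTypeR R] (affine c b).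
Proof.
by apply: (@measurable_funD _ (measurableTypeR R)) => //; apply: measurable_funM.
Qed.

(** The pushforward scaled by [c] agrees with Lebesgue measure on the intervals ]x, y], and these
    determine it. *)
Lemma lebesgue_measure_affine (c b : R) (A : set R) : 0 < c -> measurable A ->
  mu ((fun x => c * x + b) @^-1` A) = (c^-1%:E * mu A)%E.
Proof.
move=> c0 mA.
pose nu := mscale (NngNum (ltW c0)) (pushforward mu (affine c b)).
have mf := measurable_affine c b.
have nuE B : nu mf B = (c%:E * mu (affine c b @^-1` B))%E by [].
suff -> : mu A = (c%:E * mu (affine c b @^-1` A))%E.
  by rewrite muleA -EFinM mulVf ?gt_eqF// mul1e.
apply: (@lebesgue_measure_unique R (nu mf)) mA.
move=> _ [[x y] _ <-].
rewrite [RHS]nuE /affine.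
have -> : (fun u => c * u + b) @^-1` `]x, y] = `](x - b) / c, (y - b) / c]%classic.
  by apply/seteqP; split=> u /=; rewrite !in_itv/= ltr_pdivrMr//
    ler_pdivlMr// ltrBlDr lerBrDr mulrC.
rewrite !lebesgue_measure_itv/= !lte_fin ltr_pM2r ?invr_gt0// ltrD2r.
case: ifPn => _; last by rewrite mule0.
by rewrite -!EFinB -EFinM; congr EFin; field; rewrite gt_eqF.
Qed.

Lemma ge0_integral_affine (c b : R) (D : set R) (f : R -> \bar R) : 0 < c ->
  measurable D -> measurable_fun D f -> (forall x, D x -> (0 <= f x)%E) ->
  (\int[mu]_(x in (fun x => (c * x + b)%R) @^-1` D) f (c * x + b)%R =
   c^-1%:E * \int[mu]_(x in D) f x)%E.
Proof.
move=> c0 mD mf f0.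
have := @ge0_integral_pushforward _ _ _ _ R _ (measurable_affine c b) mu D f mD mf.
move=> <-; last by move=> y; rewrite inE; exact: f0.
have ci0 : 0 <= c^-1 by rewrite invr_ge0 ltW.
rewrite -(ge0_integral_mscale mu mD (NngNum ci0))//.
apply: eq_measure_integral => B mB _.
exact: lebesgue_measure_affine.
Qed.

Lemma ae_lebesgue_translation (b : R) (P : R -> Prop) :
  {ae mu, forall x, P x} -> {ae mu, forall x, P (x + b)}.
Proof.
move=> [N [mN N0 PN]].
exists ((fun x => 1 * x + b) @^-1` N); split.
- by rewrite -[X in measurable X]setTI; exact: measurable_affine.
- by rewrite lebesgue_measure_affine// N0 mule0.
- by move=> x /= Px; apply: PN => /=; rewrite mul1r.
Qed.

(** A nonempty open interval has positive measure. This is how a contradiction at one point is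
    extracted from statements on supports and essential suprema. *)
Lemma ae_itv_witness (a b : R) (P : R -> Prop) : a < b ->
  {ae mu, forall x, P x} -> exists2 x, a < x < b & P x.
Proof.
move=> ab aeP; apply: contrapT => noP.
have neg : mu.-negligible (`]a, b[%classic : set R).
  apply: negligibleS aeP => x; rewrite /= in_itv/= => xab Px.
  by apply: noP; exists x.
have : mu (`]a, b[%classic : set R) = 0%E by exact: measure_negligible neg.
rewrite lebesgue_measure_itv/= lte_fin ab => /eqP.
by rewrite -EFinB eqe subr_eq0 gt_eqF.
Qed.

End affine_change_of_variables.

(** * Absolutely continuous functions *)

Section absolute_continuity.
Context {R : realType}.
Notation mu := (@lebesgue_measure R).

Lemma sum_length_le (n : nat) (u v : 'I_n -> R) (U : set R) :
  (forall i, u i <= v i) ->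
  trivIset [set: 'I_n] (fun i => [set` `]u i, v i[]) ->
  measurable U -> (forall i, [set` `]u i, v i[] `<=` U) ->
  ((\sum_(i < n) (v i - u i))%:E <= mu U)%E.
Proof.
move=> uv tuv mU uvU.
have -> : ((\sum_(i < n) (v i - u i))%:E =
    mu (\big[setU/set0]_(i < n) `]u i, v i[%classic))%E.
  rewrite measure_bigsetU_ord//.
  rewrite -sumEFin; apply: eq_bigr => i _.
  rewrite -[RHS]/(mu `]u i, v i[%classic) lebesgue_measure_itv/= lte_fin.
  case: ltP => // vu; congr EFin.
  by apply/eqP; rewrite subr_eq0 eq_le vu uv.
apply: le_measure; rewrite ?inE//.
- exact: bigsetU_measurable.
- by apply: (big_ind (fun X => X `<=` U)) => // X Y XU YU t [/XU|/YU].
Qed.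

(** The supremum of this set is the variation of [f] on [a, x] counted inside [U] only. The families
    need not cover [U], so sums for a smaller [x] remain sums for a larger one. *)
Definition variation_sums (f : R -> R) (U : set R) (a x : R) : set R :=
  [set s | exists n (u v : 'I_n -> R),
    [/\ forall i, a <= u i /\ u i <= v i /\ v i <= x,
        trivIset [set: 'I_n] (fun i => [set` `]u i, v i[]),
        forall i, [set` `]u i, v i[] `<=` U &
        s = \sum_(i < n) `|f (v i) - f (u i)|]].

Lemma variation_sums0 f U a x : variation_sums f U a x 0.
Proof.
exists 0%N, (fun=> 0), (fun=> 0); split; rewrite ?big_ord0//; try by case.
Qed.

Lemma sub_variation_sums f U a x y : x <= y ->
  variation_sums f U a x `<=` variation_sums f U a y.
Proof.
move=> xy s [n [u [v [auvx tuv uvU ->]]]]; exists n, u, v; split=> // i.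
by have [? [? vx]] := auvx i; do 2![split=> //]; exact: le_trans vx xy.
Qed.

(** All intervals of the given family end at or before [x], so ]x, y[ is disjoint from them and can
    be added at index [ord0]. *)
Lemma variation_sums_add f U a x y s : a <= x -> x <= y ->
  [set` `]x, y[] `<=` U -> variation_sums f U a x s ->
  variation_sums f U a y (`|f y - f x| + s).
Proof.
move=> ax xy xyU [n [u [v [auvx tuv uvU ->]]]].
pose u' (i : 'I_n.+1) := if unlift ord0 i is Some j then u j else x.
pose v' (i : 'I_n.+1) := if unlift ord0 i is Some j then v j else y.
have disj i t : [set` `]u i, v i[] t -> [set` `]x, y[] t -> False.
  have [_ [_ vx]] := auvx i.
  rewrite /= !in_itv/= => /andP[_ tv] /andP[xt _].
  by have := lt_trans xt (lt_le_trans tv vx); rewrite ltxx.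
exists n.+1, u', v'; split.
- move=> i; rewrite /u' /v'; case: unliftP => [j|] _; last by [].
  by have [? [? vx]] := auvx j; do 2![split=> //]; exact: le_trans vx xy.
- move=> i j _ _; rewrite /u' /v'.
  case: unliftP => [i'|] -> ; case: unliftP => [j'|] -> // [t [/= ti tj]].
  + by congr lift; apply: tuv => //; exists t.
  + by case: (disj i' t).
  + by case: (disj j' t).
- by move=> i; rewrite /u' /v'; case: unliftP => [j|] _ //.
- rewrite big_ord_recl /u' /v' unlift_none; congr (_ + _).
  by apply: eq_bigr => i _; rewrite liftK.
Qed.

(** Continuity from the left is the form used at the supremum of a set, which is approached from the
    left. *)
Lemma abs_continuous_cont (a b c : R) f : abs_continuous a b f ->
  a <= c <= b -> forall e, 0 < e ->
  exists2 d, 0 < d & forall x, a <= x <= c -> c - d < x -> `|f c - f x| < e.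
Proof.
move=> acf /andP[ac cb] e e0; have [d d0 H] := acf _ e0; exists d => // x /andP[ax xc] cdx.
have := H 1%N (fun=> x) (fun=> c); rewrite !big_ord1; apply => //.
- by move=> i j _ _ _; rewrite !ord1.
- by rewrite ltrBlDr addrC -ltrBlDr.
Qed.

(* The increments of f inside the open cover U of the exceptional null set are
   absorbed by the variation of f in U, which absolute continuity keeps small. *)
Lemma abs_continuous_le_increment (a b : R) (f phi : R -> R) :
  a <= b -> abs_continuous a b f -> {in `[a, b] &, nondecreasing_fun phi} ->
  {ae mu, forall x, x \in `]a, b[ -> forall e, 0 < e ->
     \forall t \near x^'+, `|f t - f x| <= phi t - phi x + e * (t - x)} ->
  `|f b - f a| <= phi b - phi a.
Proof.
move=> ab acf ndphi [N [mN N0 badN]].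
apply/ler_addgt0Pr => e' e'0.
(* The error in the slope contributes e * (b - a) and the variation inside [U] at most [e]; together
   they make e'. *)
pose e := e' / (b - a + 1).
have ba1 : 0 < b - a + 1 by rewrite ltr_wpDl// subr_ge0.
have e0 : 0 < e by rewrite divr_gt0.
have [d d0 acd] := acf _ e0.
(* The bound on small increments is given in ]a, b[ only, so the endpoint [a] is counted as
   exceptional. *)
have mNa : measurable (N `|` [set a]) by apply: measurableU.
have Na0 : mu (N `|` [set a]) = 0%E.
  by rewrite measureU0//; exact: lebesgue_measure_set1.
have Nay : (mu (N `|` [set a]) < +oo)%E by rewrite Na0.
have [U [oU NU Ud']] := lebesgue_regularity_outer mNa Nay d0.
have mU : measurable U by exact: open_measurable.
have Ud : (mu U < d%:E)%E.
  have UE : mu U = (mu (U `\` (N `|` [set a])) + mu (N `|` [set a]))%E.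
    rewrite -measureU//; [|exact: measurableD|by rewrite setDKI].
    by rewrite setDKU.
  by rewrite UE Na0 adde0.
pose V x := sup (variation_sums f U a x).
have Vub x : x <= b -> ubound (variation_sums f U a x) e.
  move=> xb s [n [u [v [auvx tuv uvU ->]]]]; apply/ltW/acd => //.
    by move=> i; have [? [? vx]] := auvx i; do 2![split=> //]; exact: le_trans vx xb.
  rewrite -lte_fin; apply: le_lt_trans Ud; apply: sum_length_le => // i.
  by have [? []] := auvx i.
have hsV x : x <= b -> has_sup (variation_sums f U a x).
  by move=> xb; split; [exists 0; exact: variation_sums0|exists e; exact: Vub].
have V0 x : x <= b -> 0 <= V x.
  by move=> xb; apply: ub_le_sup; [exact: (hsV x xb).2|exact: variation_sums0].
have Ve x : x <= b -> V x <= e.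
  by move=> xb; apply: ge_sup; [exact: (hsV x xb).1|exact: Vub].
have Vnd x y : x <= y -> y <= b -> V x <= V y.
  move=> xy yb; apply: ge_sup; first exact: (hsV x (le_trans xy yb)).1.
  move=> s /(sub_variation_sums xy); apply: ub_le_sup; exact: (hsV y yb).2.
have Vstep x y : a <= x -> x <= y -> y <= b -> [set` `]x, y[] `<=` U ->
    V x + `|f y - f x| <= V y.
  move=> ax xy yb xyU; rewrite -lerBrDr.
  apply: ge_sup; first exact: (hsV x (le_trans xy yb)).1.
  move=> s xs; rewrite lerBrDr addrC; apply: ub_le_sup; first exact: (hsV y yb).2.
  exact: variation_sums_add.
(* [psi] is the growth granted to [f] from [a] on: that of [phi], the slope error and the variation
   inside [U]. The set [S] of points where the grant suffices contains its supremum [c], by left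
   continuity of [f] and monotonicity of [psi]; it remains to exclude c < b. *)
pose psi x := phi x - phi a + e * (x - a) + V x.
have psind x y : a <= x -> x <= y -> y <= b -> psi x <= psi y.
  move=> ax xy yb; rewrite /psi lerD//; last exact: Vnd.
  rewrite lerD//; last by rewrite ler_pM2l// lerD2r.
  by rewrite lerD2r ndphi// in_itv/= ?ax ?(le_trans ax xy)// ?yb (le_trans xy yb).
pose S := [set x | a <= x <= b /\ `|f x - f a| <= psi x].
have Sa : S a.
  split; first by rewrite lexx ab.
  by rewrite /psi !subrr normr0 mulr0 !add0r V0.
have hsS : has_sup S.
  by split; [exists a|exists b => x [/andP[]]].
pose c := sup S.
have ac : a <= c by apply: ub_le_sup => //; exact: hsS.2.
have cb : c <= b by apply: ge_sup; [exists a|move=> x [/andP[]]].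
have Sc : `|f c - f a| <= psi c.
  rewrite leNgt; apply/negP => psic.
  have acb : a <= c <= b by rewrite ac cb.
  have eta0 : 0 < `|f c - f a| - psi c by rewrite subr_gt0.
  have [d' d'0 fd'] := abs_continuous_cont acf acb eta0.
  have [x Sx cdx] := sup_adherent d'0 hsS.
  have xc : x <= c by apply: ub_le_sup => //; exact: hsS.2.
  case: Sx => /andP[ax xb] fx.
  have := fd' x; rewrite ax xc => /(_ isT cdx).
  have := psind x c ax xc cb.
  have := ler_distD (f x) (f c) (f a).
  lra.
have [cb'|bc] := ltP c b; last first.
  have cE : c = b by apply/eqP; rewrite eq_le cb bc.
  rewrite cE in Sc; apply: (le_trans Sc).
  rewrite /psi -addrA lerD2l.
  apply: (@le_trans _ _ (e * (b - a) + e)); first by rewrite lerD2l Ve.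
  by rewrite -{2}(mulr1 e) -mulrDr /e divfK// gt_eqF.
exfalso.
suff [y [cy yb Sy]] : exists y, [/\ c < y, y <= b & `|f y - f a| <= psi y].
  have : y <= c.
    apply: ub_le_sup; first exact: hsS.2.
    by split=> //; rewrite yb (le_trans ac (ltW cy)).
  by rewrite leNgt cy.
(* The bound extends to the right of [c] in both cases: in [U] the increment of [V] pays for it, and
   outside [U] the point [c] is not exceptional, so [phi] and the slope error pay. *)
have [Uc|nUc] := pselect (U c).
  have : \forall t \near c^'+, [set` `[c, t]] `<=` U.
    have /nbhs_ballP[r /= r0 rU] : nbhs c U by apply: open_nbhs_nbhs.
    near=> t => z /=; rewrite in_itv/= => /andP[cz zt].
    apply: rU; rewrite /ball/= distrC ger0_norm ?subr_ge0// ltrBlDr.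
    apply: le_lt_trans zt _; near: t; apply: nbhs_right_lt.
    by rewrite ltrDr.
  move=> nU.
  near c^'+ => y.
  have cy : c < y by near: y; exact: nbhs_right_gt.
  have yb : y <= b by near: y; exact: nbhs_right_le.
  exists y; split => //.
  have cyU : [set` `[c, y]] `<=` U by near: y.
  have := Vstep c y ac (ltW cy) yb (subset_trans (@subset_itv_oo_cc _ _ _ _) cyU).
  have : phi c <= phi y.
    apply: ndphi; rewrite ?in_itv/= ?ac ?cb ?yb ?(ltW cy)//.
    by rewrite (le_trans ac (ltW cy)).
  have : e * (c - a) <= e * (y - a) by rewrite ler_pM2l// lerD2r ltW.
  have := ler_distD (f c) (f y) (f a).
  rewrite /psi in Sc *; lra.
have ac' : a < c.
  rewrite lt_neqAle ac andbT; apply/negP => /eqP acE; apply: nUc; apply: NU.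
  by right; rewrite acE.
have good : forall e, 0 < e ->
     \forall t \near c^'+, `|f t - f c| <= phi t - phi c + e * (t - c).
  apply: contrapT => bad; apply: nUc; apply: NU; left; apply: badN => /= H.
  by apply: bad; apply: H; rewrite in_itv/= ac' cb'.
have {}good := good _ e0.
near c^'+ => y.
have cy : c < y by near: y; exact: nbhs_right_gt.
have yb : y <= b by near: y; exact: nbhs_right_le.
exists y; split => //.
have : `|f y - f c| <= phi y - phi c + e * (y - c) by near: y.
have := Vnd c y (ltW cy) yb.
have := ler_distD (f c) (f y) (f a).
rewrite /psi in Sc *.
lra.
Unshelve. all: by end_near. Qed.

End absolute_continuity.

(** * The fundamental theorem of calculus as an inequality *)

Section ftc_inequality.
Context {R : realType}.
Notation mu := (@lebesgue_measure R).

Lemma ae_is_derive_primitive (w : R -> R) :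
  mu.-integrable [set: R] (EFin \o w) ->
  {ae mu, forall x : R, is_derive x 1
     (fun y => \int[mu]_(t in [set` `]-oo, y]]) w t) (w x)}.
Proof.
move=> iw.
have lw := open_integrable_locally openT iw.
have /FTC1Ny/(_ lw) : forall y, mu.-integrable `]-oo, y] (EFin \o w).
  by move=> y; exact: integrableS iw.
apply: filterS; first exact: (ae_filter_ringOfSetsType mu).
move=> x [dx Ex]; split=> //.
by rewrite -derive1E.
Qed.

Lemma is_derive_near_right (f : R -> R) (x l e : R) : is_derive x 1 f l ->
  0 < e -> \forall t \near x^'+, `|f t - f x - l * (t - x)| <= e * (t - x).
Proof.
move=> dfx e0.
have /cvgrPdist_le/(_ _ e0) : (fun h => h^-1 *: ((f \o shift x) (h *: (1 : R)) - f x)) @ 0^' --> l.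
  by rewrite -(@derive_val _ _ _ _ _ _ _ dfx); exact: (@ex_derive _ _ _ _ _ _ _ dfx).
move=> /nbhs_ballP[r /= r0 rP].
near=> t.
have xt : x < t by near: t; exact: nbhs_right_gt.
have tx0 : 0 < t - x by rewrite subr_gt0.
have := rP (t - x); rewrite /ball/= sub0r normrN gtr0_norm// gt_eqF// => /(_ _ isT).
rewrite /GRing.scale/= mulr1 subrK => H.
have {}H := H (_ : t - x < r).
rewrite -(@ler_pM2r _ (t - x)^-1) ?invr_gt0// mulfK ?gt_eqF//.
rewrite -[X in _ * X](@gtr0_norm _ (t - x)^-1) ?invr_gt0// -normrM.
apply: le_trans (H _); last first.
  rewrite ltrBlDr; near: t; apply: nbhs_right_lt; rewrite ltrDr//.
by rewrite mulrBl mulfK ?gt_eqF// distrC [in X in _ <= X]mulrC.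
Unshelve. all: by end_near. Qed.

(** Take for [phi] the primitive of |g|: at almost every point f' = g and phi' = |g|, so right
    increments of [f] exceed those of [phi] by at most e * (t - x), and
    [abs_continuous_le_increment] applies. An infinite integral makes the claim trivial. *)
Lemma abs_continuous_le_integral (a b : R) (f g : R -> R) : a <= b ->
  abs_continuous a b f -> measurable_fun `]a, b[ g ->
  {ae mu, forall x, x \in `]a, b[ -> is_derive x 1 f (g x)} ->
  (`|f b - f a|%:E <= \int[mu]_(x in `]a, b[) `|g x|%:E)%E.
Proof.
move=> ab acf mg dfg.
have [ioo|] := ltP (\int[mu]_(x in `]a, b[) `|g x|%:E)%E +oo%E; last first.
  by rewrite leye_eq => /eqP ->; rewrite leey.
have ig : mu.-integrable `]a, b[ (EFin \o (Num.norm \o g)).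
  apply/integrableP; split.
    by apply/measurable_EFinP; exact: measurableT_comp.
  by under eq_integral do rewrite /= normr_id.
pose w := (Num.norm \o g) \_ `]a, b[.
have iw : mu.-integrable setT (EFin \o w).
  by rewrite -restrict_EFin; apply/integrable_restrict => //; rewrite setTI.
pose phi y := \int[mu]_(t in [set` `]-oo, y]]) w t.
have w0 x : 0 <= w x by rewrite /w patchE; case: ifP => //=.
have iwS A : measurable A -> mu.-integrable A (EFin \o w).
  by move=> mA; exact: integrableS iw.
have phiB x y : x <= y -> phi y - phi x = \int[mu]_(t in [set` `]x, y]]) w t.
  by move=> xy; rewrite /phi Rintegral_itvB//; exact: iwS.
have ndphi x y : x <= y -> phi x <= phi y.
  by move=> xy; rewrite -subr_ge0 phiB// Rintegral_ge0.
have -> : (\int[mu]_(x in `]a, b[) `|g x|%:E = (phi b - phi a)%:E)%E.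
  rewrite phiB// /Rintegral fineK; last first.
    by apply: integrable_fin_num => //; exact: iwS.
  rewrite -(@integral_itv_bndo_bndc _ (BRight a) b); last first.
    by apply: measurable_int (iwS `]a, b[%classic _).
  by apply: eq_integral => x xab; rewrite /w/= patchE xab.
rewrite lee_fin; apply: abs_continuous_le_increment => //.
  by move=> x y _ _; exact: ndphi.
apply: filterS2 dfg (ae_is_derive_primitive iw); first exact: (ae_filter_ringOfSetsType mu).
move=> x dfx dphix xab e e0.
have {}dfx := dfx xab.
have e20 : 0 < e / 2 by rewrite divr_gt0.
have f1 := is_derive_near_right dfx e20.
have f2 := is_derive_near_right dphix e20.
near=> t.
have xt : x < t by near: t; exact: nbhs_right_gt.
have : `|f t - f x - g x * (t - x)| <= e / 2 * (t - x) by near: t.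
have : `|phi t - phi x - w x * (t - x)| <= e / 2 * (t - x) by near: t.
rewrite /w patchE mem_set//= ler_distlC => /andP[_ H1] H2.
have : `|f t - f x| <= `|f t - f x - g x * (t - x)| + `|g x| * (t - x).
  have -> : `|g x| * (t - x) = `|g x * (t - x)|.
    by rewrite normrM (@gtr0_norm _ (t - x)) ?subr_gt0.
  by rewrite -{1}(subrK (g x * (t - x)) (f t - f x)) ler_normD.
lra.
Unshelve. all: by end_near. Qed.

End ftc_inequality.

(** * Powers and the Gamma function *)

Section power_integrals.
Context {R : realType}.
Notation mu := (@lebesgue_measure R).

Lemma ler_powRN (k x y : R) : 0 <= k -> 0 < x -> x <= y ->
  y `^ (- k) <= x `^ (- k).
Proof.
move=> k0 x0 xy; have y0 := lt_le_trans x0 xy.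
rewrite !powRN lef_pV2 ?posrE ?powR_gt0//.
by rewrite ge0_ler_powR// nnegrE ltW.
Qed.

Lemma powRN_cvg0 (k : R) : 0 < k -> x `^ (- k) @[x --> +oo] --> (0 : R).
Proof.
move=> k0; apply/cvgrPdist_le => /= e e0; near=> x.
rewrite sub0r normrN ger0_norm ?powR_ge0//.
(* The threshold e^(-1/k) is the point where x^-k equals [e]. *)
have <- : (e `^ (- k^-1)) `^ (- k) = e.
  by rewrite -powRrM mulrNN mulVf ?gt_eqF// powRr1// ltW.
apply: ler_powRN; rewrite ?powR_gt0 ?(ltW k0)//.
Unshelve. all: by end_near. Qed.

Let is_derive_powR_div (p x : R) : p != 0 -> 0 < x ->
  is_derive x 1 (fun t : R => t `^ p / p) (x `^ (p - 1)).
Proof.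
move=> p0 x0.
have d := is_derive1_powR p x0.
have -> : (fun t : R => t `^ p / p) = p^-1 \*: (@powR R ^~ p).
  by apply/funext => t /=; rewrite mulrC.
have -> : x `^ (p - 1) = p^-1 *: (p * x `^ (p - 1)).
  by rewrite /GRing.scale/= mulrA mulVf// mul1r.
exact: is_deriveZ.
Qed.

Let powR_div_cvg (p x : R) : p != 0 -> 0 < x ->
  t `^ p / p @[t --> x] --> x `^ p / p.
Proof.
move=> p0 x0.
have d : derivable (fun t : R => t `^ p / p) x 1.
  exact: (@ex_derive _ _ _ _ _ _ _ (is_derive_powR_div p0 x0)).
have : {for x, continuous (fun t : R => t `^ p / p)}.
  by apply/differentiable_continuous/derivable1_diffP.
exact.
Qed.

Lemma measurable_funT_powR (p : R) (D : set R) :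
  measurable_fun D (fun x => x `^ p).
Proof. exact: measurable_funTS (measurable_powR p). Qed.

Lemma integral_powR (p s h : R) : p != 0 -> 0 < s -> s <= h ->
  (\int[mu]_(t in `]s, h[) (t `^ (p - 1))%:E = ((h `^ p - s `^ p) / p)%:E)%E.
Proof.
move=> p0 s0; rewrite le_eqVlt => /predU1P[->|sh].
  by rewrite set_itvoo0 integral_set0 subrr mul0r.
have h0 : 0 < h by exact: lt_trans sh.
rewrite -(@integral_itv_bndoo _ _ _ _ true false); last first.
  by apply/measurable_EFinP; exact: measurable_funT_powR.
rewrite (@continuous_FTC2 _ _ (fun t => t `^ p / p) _ _ sh).
- by rewrite -EFinB mulrBl.
- apply: derivable_within_continuous => x; rewrite in_itv/= => /andP[sx _].
  exact: (@ex_derive _ _ _ _ _ _ _ (is_derive1_powR _ (lt_le_trans s0 sx))).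
- split.
  + move=> x; rewrite in_itv/= => /andP[sx _].
    by have [] := is_derive_powR_div p0 (lt_trans s0 sx).
  + exact: cvg_at_right_filter (powR_div_cvg p0 s0).
  + exact: cvg_at_left_filter (powR_div_cvg p0 h0).
- move=> x; rewrite in_itv/= => /andP[sx _].
  rewrite derive1E.
  exact: (@derive_val _ _ _ _ _ _ _ (is_derive_powR_div p0 (lt_trans s0 sx))).
Qed.

Lemma integral_powR_tail (k h : R) : 0 < k -> 0 < h ->
  (\int[mu]_(t in `]h, +oo[) (t `^ (- k - 1))%:E = (h `^ (- k) / k)%:E)%E.
Proof.
move=> k0 h0; have nk0 : - k != 0 by rewrite oppr_eq0 gt_eqF.
rewrite integral_itv_obnd_cbnd; last first.
  by apply/measurable_EFinP; exact: measurable_funT_powR.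
rewrite (@ge0_continuous_FTC2y _ _ (fun t => t `^ (- k) / - k) _ 0).
- by rewrite sub0e -EFinN; congr EFin; rewrite invrN mulrN opprK.
- by move=> x _; exact: powR_ge0.
- apply: derivable_within_continuous => x; rewrite in_itv/= andbT => hx.
  exact: (@ex_derive _ _ _ _ _ _ _ (is_derive1_powR _ (lt_le_trans h0 hx))).
- by rewrite -(mul0r (- k)^-1); apply: cvgM; [exact: powRN_cvg0|exact: cvg_cst].
- by move=> x hx; have [] := is_derive_powR_div nk0 (lt_trans h0 hx).
- exact: cvg_at_right_filter (powR_div_cvg nk0 h0).
- move=> x; rewrite in_itv/= andbT => hx.
  rewrite derive1E.
  exact: (@derive_val _ _ _ _ _ _ _ (is_derive_powR_div nk0 (lt_trans h0 hx))).
Qed.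

(** For p < 1 the integrand is singular at 0, so the interval is exhausted by ]h / (n + 2), h[,
    where the integral is at most h^p / p, and monotone convergence is applied. *)
Lemma integral_powR_lty (p h : R) : 0 < p ->
  (\int[mu]_(t in `]0%R, h[) (t `^ (p - 1))%:E < +oo)%E.
Proof.
move=> p0; have [h0|h0] := leP h 0%R.
  by rewrite set_itv_ge ?integral_set0// bnd_simp -leNgt.
pose F n : set R := `]h / n.+2%:R, h[%classic.
have UF : \bigcup_n F n = `]0, h[%classic.
  apply/seteqP; split => [x [n _]|x]; rewrite /F/= !in_itv/= => /andP[hx xh].
    by rewrite xh andbT (lt_trans _ hx)// divr_gt0.
  exists (Num.truncn (h / x)) => //=; rewrite in_itv/= xh andbT.
  rewrite ltr_pdivrMr// mulrC -ltr_pdivrMr//.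
  apply: lt_le_trans (truncnS_gt _) _.
  by rewrite ler_nat.
have : (\int[mu]_(x in F n) (x `^ (p - 1))%:E @[n --> \oo] -->
    \int[mu]_(x in \bigcup_i F i) (x `^ (p - 1))%:E)%E.
  apply: ge0_nondecreasing_set_cvg_integral.
  - move=> m n mn; apply/subsetPset => x; rewrite /F/= !in_itv/= => /andP[hx ->].
    rewrite andbT (le_lt_trans _ hx)// ler_pM2l// lef_pV2 ?posrE//.
    by rewrite ler_nat !ltnS.
  - by move=> i; exact: measurable_itv.
  - by move=> i; apply/measurable_EFinP; exact: measurable_funT_powR.
  - by move=> i x _; rewrite lee_fin powR_ge0.
rewrite UF => cvgF.
apply: (@le_lt_trans _ _ (h `^ p / p)%:E); last by rewrite ltry.
rewrite -(cvg_lim (@ereal_hausdorff R) cvgF).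
apply: lime_le; first by apply/cvg_ex; eexists; exact: cvgF.
apply: nearW => n.
have hn : 0 < h / n.+2%:R by rewrite divr_gt0.
rewrite integral_powR ?gt_eqF//.
  by rewrite lee_fin ler_pM2r ?invr_gt0// lerBlDr lerDl powR_ge0.
by rewrite ler_pdivrMr// ler_peMr ?ler1n// ltW.
Qed.

Lemma ge0_integral_split (h : R) (f : R -> \bar R) : 0 < h ->
  measurable_fun (`]0, +oo[%classic : set R) f -> (forall x, 0 < x -> (0 <= f x)%E) ->
  (\int[mu]_(x in `]0%R, +oo[) f x =
   \int[mu]_(x in `]0%R, h[) f x + \int[mu]_(x in `]h, +oo[) f x)%E.
Proof.
move=> h0 mf f0.
rewrite (@itv_bndbnd_setU _ _ _ (BLeft h)) ?bnd_simp//.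
rewrite ge0_integral_setU//.
- congr (_ + _)%E; rewrite -integral_itv_obnd_cbnd//.
  by apply: measurable_funS mf => // x/=; rewrite !in_itv/= !andbT; exact: lt_trans.
- by rewrite -itv_bndbnd_setU ?bnd_simp.
- rewrite -itv_bndbnd_setU ?bnd_simp// => x /=.
  by rewrite in_itv/= andbT; exact: f0.
- apply/disj_setPS => x [/=]; rewrite !in_itv/= !andbT => /andP[_ xh].
  by rewrite leNgt xh.
Qed.

End power_integrals.

(** * Tonelli's theorem on a triangle, and values of [Gamma] *)

Section tonelli_gamma.
Context {R : realType}.
Notation mu := (@lebesgue_measure R).

(** The primitive is a section integral of w(s) times the indicator of s < t, so Tonelli's theorem
    gives its measurability. *)
Lemma measurable_primitive (h : R) (w : R -> R) :
  measurable_fun `]0, h[ w -> (forall s, 0 <= w s) ->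
  measurable_fun (`]0, h[%classic : set R)
    (fun t => \int[mu]_(s in `]0%R, t[) (w s)%:E)%E.
Proof.
move=> mw w0.
pose W : measurableTypeR R -> R := w \_ `]0, h[.
pose T : set (measurableTypeR R * measurableTypeR R) := [set z | z.1 < z.2].
pose phi (z : measurableTypeR R * measurableTypeR R) : \bar R :=
  (W z.1 * \1_T z)%:E.
have E : {in (`]0, h[%classic : set R), fubini_G mu phi =1
    (fun t => \int[mu]_(s in `]0%R, t[) (w s)%:E)%E}.
  move=> t; rewrite inE/= in_itv/= => /andP[t0 th].
  rewrite /fubini_G [RHS]integral_mkcond; apply: eq_integral => s _.
  rewrite patchE /phi/= /W !patchE indicE.
  case: (boolP (s \in `]0, t[%classic)); rewrite ?notin_setE ?inE/= in_itv/=.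
    move=> /andP[s0 st]; rewrite !mem_set ?mulr1// /= in_itv/=.
    by rewrite s0 (lt_trans st th).
  move=> /negP; rewrite negb_and => nst.
  case: ifPn; last by rewrite !mul0r.
  rewrite inE/= in_itv/= => /andP[s0 _].
  rewrite s0/= in nst.
  by rewrite memNset ?mulr0//=; exact/negP.
have mW : measurable_fun setT W by apply/(measurable_restrictT w (measurable_itv _)).
have mT : measurable T.
  rewrite -[T]setTI; apply: (measurable_fun_ltr measurable_fst measurable_snd) => //.
have phi0 z : (0 <= phi z)%E.
  by rewrite lee_fin mulr_ge0// /W patchE; case: ifPn.
have mphi : measurable_fun setT phi.
  apply/measurable_EFinP; apply: measurable_funM; last exact: measurable_indic.
  exact: measurableT_comp.
apply: (eq_measurable_fun _ E); apply: measurable_funTS.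
exact: measurable_fun_fubini_tonelli_G.
Qed.

(** This is where [tau] originates: on the triangle 0 < s < t < h, integrating first in t gives
    \int_s^h t^(-k-1) dt = (s^-k - h^-k) / k. *)
Lemma integral_powR_primitive (k h : R) (w : R -> R) : 0 < k -> 0 < h ->
  measurable_fun `]0, h[ w -> (forall s, 0 < s < h -> 0 <= w s) ->
  (\int[mu]_(t in `]0%R, h[)
      ((t `^ (- k - 1))%:E * \int[mu]_(s in `]0%R, t[) (w s)%:E) =
   k^-1%:E * \int[mu]_(s in `]0%R, h[) (w s * (s `^ (- k) - h `^ (- k)))%:E)%E.
Proof.
move=> k0 h0 mw w0.
(* Extending both factors by 0 outside ]0, h[ turns the integrals over the triangle into integrals
   over the plane. *)
pose W : measurableTypeR R -> R := w \_ `]0, h[.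
pose K : measurableTypeR R -> R := (fun t => t `^ (- k - 1)) \_ `]0, h[.
pose T : set (measurableTypeR R * measurableTypeR R) := [set z | z.1 < z.2].
have mW : measurable_fun setT W by apply/(measurable_restrictT w (measurable_itv _)).
have mK : measurable_fun setT K.
  apply/(measurable_restrictT _ (measurable_itv _)). exact: measurable_funT_powR.
have mT : measurable T.
  rewrite -[T]setTI; apply: (measurable_fun_ltr measurable_fst measurable_snd) => //.
have W0 s : 0 <= W s.
  by rewrite /W patchE; case: ifPn => //; rewrite inE/= in_itv/=; exact: w0.
have K0 t : 0 <= K t.
  by rewrite /K patchE; case: ifPn => // _; exact: powR_ge0.
pose phi (z : measurableTypeR R * measurableTypeR R) : \bar R :=
  (W z.1 * K z.2 * \1_T z)%:E.
have -> : (\int[mu]_(t in `]0%R, h[)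
      ((t `^ (- k - 1))%:E * \int[mu]_(s in `]0%R, t[) (w s)%:E) =
    \int[mu]_y \int[mu]_x phi (x, y))%E.
  rewrite integral_mkcond; apply: eq_integral => t _.
  rewrite patchE; case: ifPn => [|tnh]; last first.
    rewrite integral0_eq// => s _.
    by rewrite /phi/= /K patchE (negbTE tnh) mulr0 mul0r.
  rewrite inE/= in_itv/= => /andP[t0 th].
  rewrite -ge0_integralZl_EFin ?powR_ge0//; last 2 first.
  - by move=> s; rewrite /= in_itv/= => /andP[s0 st]; rewrite lee_fin w0// s0 (lt_trans st th).
  - apply/measurable_EFinP; apply: measurable_funS mw => // s /=.
    by rewrite !in_itv/= => /andP[-> st]; rewrite (lt_trans st th).
  rewrite integral_mkcond; apply: eq_integral => s _.
  rewrite patchE /phi/= /W /K !patchE [t \in _]mem_set/=; last by rewrite in_itv/= t0 th.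
  rewrite indicE; case: ifPn; rewrite ?notin_setE ?inE/= in_itv/=.
    move=> /andP[s0 st]; rewrite !mem_set ?mulr1 ?[w s * _]mulrC// /= in_itv/=.
    by rewrite s0 (lt_trans st th).
  move=> /negP; rewrite negb_and => nst.
  case: ifPn; last by rewrite !mul0r.
  rewrite inE/= in_itv/= => /andP[s0 _].
  rewrite s0/= in nst.
  by rewrite memNset ?mulr0//=; exact/negP.
have <- : (\int[mu]_x \int[mu]_y phi (x, y) = k^-1%:E * \int[mu]_(s in `]0%R, h[)
    (w s * (s `^ (- k) - h `^ (- k)))%:E)%E.
  rewrite [in RHS]integral_mkcond.
  rewrite -ge0_integralZl_EFin ?invr_ge0 ?(ltW k0)//; last 2 first.
  - move=> s _; rewrite patchE; case: ifPn => //; rewrite inE/= in_itv/= => /andP[s0 sh].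
    by rewrite lee_fin mulr_ge0 ?w0 ?s0// subr_ge0 ler_powRN// ltW.
  - apply/(measurable_restrictT _ (measurable_itv _)); apply/measurable_EFinP; apply: measurable_funM => //.
    by apply: measurable_funB => //; exact: measurable_funT_powR.
  apply: eq_integral => s _; rewrite patchE; case: ifPn => [|snh]; last first.
    rewrite mule0 integral0_eq// => t _.
    by rewrite /phi/= /W patchE (negbTE snh) !mul0r.
  rewrite inE/= in_itv/= => /andP[s0 sh].
  transitivity (\int[mu]_(t in `]s, h[) ((w s)%:E * (t `^ (- k - 1))%:E))%E.
    rewrite [RHS]integral_mkcond; apply: eq_integral => t _.
    rewrite patchE /phi/= /W /K !patchE [s \in _]mem_set/=; last by rewrite in_itv/= s0 sh.
    rewrite indicE; case: (boolP (t \in [set` `]s, h[])); rewrite ?notin_setE ?inE/= in_itv/=; last first.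
      case: (boolP (t \in [set` `]0, h[])); last by rewrite mulr0 mul0r.
      rewrite inE/= in_itv/= => /andP[t0 th] /negP; rewrite th andbT => nst.
      by rewrite memNset ?mulr0//=; exact/negP.
    move=> /andP[st th]; rewrite !mem_set ?mulr1// /= in_itv/=.
    by rewrite (lt_trans s0 st).
  rewrite ge0_integralZl_EFin ?w0 ?s0//; last 2 first.
  - by move=> t _; rewrite lee_fin powR_ge0.
  - by apply/measurable_EFinP; exact: measurable_funT_powR.
  rewrite integral_powR ?oppr_eq0 ?gt_eqF// ?(ltW sh)//.
  by rewrite -!EFinM; congr EFin; field; rewrite gt_eqF.
have mphi : measurable_fun setT phi.
  apply/measurable_EFinP; apply: measurable_funM; last exact: measurable_indic.
  by apply: measurable_funM; exact: measurableT_comp.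
have phi0 z : (0 <= phi z)%E.
  by rewrite lee_fin mulr_ge0 ?mulr_ge0 ?W0 ?K0// indicE ler0n.
symmetry; apply: (@fubini_tonelli _ _ (measurableTypeR R) (measurableTypeR R) R mu mu phi mphi phi0).
Qed.

(** Finiteness matters since [fine] sends an infinite integral to 0. The integrand is at most t^-k
    on ]0, 1[, and at most t^(-k-1) on ]1, +oo[ because exp(-t) <= 1 / t. *)
Lemma integral_Gamma_fin_pos (k : R) : 0 < k -> k < 1 ->
  (0 < \int[mu]_(t in `]0%R, +oo[) (t `^ (- k) * expR (- t))%:E < +oo)%E.
Proof.
move=> k0 k1.
have mf D : measurable_fun D (fun t : R => (t `^ (- k) * expR (- t))%:E).
  apply/measurable_EFinP; apply: measurable_funM; first exact: measurable_funT_powR.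
  by apply: measurableT_comp; [exact: measurable_expR|exact: oppr_measurable].
have f0 (t : R) : (0 <= (t `^ (- k) * expR (- t))%:E)%E.
  by rewrite lee_fin mulr_ge0 ?powR_ge0 ?expR_ge0.
rewrite (@ge0_integral_split _ 1); [|exact: ltr01|exact: mf|by move=> t _; exact: f0].
apply/andP; split.
  suff /lt_le_trans : (0 < \int[mu]_(t in `]0%R, 1%R[) (t `^ (- k) * expR (- t))%:E)%E.
    by apply; rewrite leeDl// integral_ge0.
  apply: (@lt_le_trans _ _ (\int[mu]_(t in `]0%R, 1%R[) (expR (-1))%:E)%E).
    rewrite integral_cst//= lebesgue_measure_itv/= lte_fin ltr01 sube0 mule1.
    by rewrite lte_fin expR_gt0.
  apply: ge0_le_integral => //.
  - exact: mf.
  - move=> t; rewrite /= in_itv/= => /andP[t0 t1]; rewrite lee_fin.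
    rewrite -[leLHS]mul1r ler_pM ?expR_ge0//.
      by apply: le_trans (ler_powRN (ltW k0) t0 (ltW t1)); rewrite powR1.
    by rewrite ler_expR lerN2 ltW.
apply: lte_add_pinfty.
  have := @integral_powR_lty R (1 - k) 1; rewrite subr_gt0 => /(_ k1).
  apply: le_lt_trans; apply: ge0_le_integral => //.
  - exact: mf.
  - by apply/measurable_EFinP; exact: measurable_funT_powR.
  - move=> t; rewrite /= in_itv/= => /andP[t0 t1]; rewrite lee_fin addrAC subrr add0r.
    by rewrite ler_piMr ?powR_ge0// -expR0 ler_expR oppr_le0 ltW.
apply: (@le_lt_trans _ _ (\int[mu]_(t in `]1%R, +oo[) (t `^ (- k - 1))%:E)%E); last first.
  by rewrite integral_powR_tail// ltry.
apply: ge0_le_integral => //.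
- exact: mf.
- by apply/measurable_EFinP; exact: measurable_funT_powR.
- move=> t; rewrite /= in_itv/= andbT => t1; rewrite lee_fin.
  have t0 := lt_trans ltr01 t1.
  rewrite powRD ?(gt_eqF t0) ?implybT// ler_wpM2l ?powR_ge0//.
  rewrite (powR_inv1 (ltW t0)) expRN lef_pV2 ?posrE ?expR_gt0//.
  by apply: le_trans (expR_ge1Dx t); rewrite lerDr.
Qed.

Lemma Gamma_1B (k : R) : 0 < k -> k < 1 ->
  Gamma (1 - k) = fine (\int[mu]_(t in `]0%R, +oo[) (t `^ (- k) * expR (- t))%:E)%E.
Proof.
move=> k0 k1; rewrite /Gamma.
have -> : Num.truncn (1 - (1 - k)) = 0%N.
  by apply/truncn_def; rewrite subKr (ltW k0) k1.
rewrite big_ord0 divr1 /Rintegral.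
by under eq_integral do rewrite addr0 addrAC subrr add0r.
Qed.

Lemma Gamma_1B_gt0 (k : R) : 0 < k -> k < 1 -> 0 < Gamma (1 - k).
Proof.
by move=> k0 k1; rewrite Gamma_1B// fine_gt0// integral_Gamma_fin_pos.
Qed.

(** At -k the definition of [Gamma] uses exactly one factor, namely -k. *)
Lemma GammaN (k : R) : 0 < k -> k < 1 -> Gamma (- k) = - (Gamma (1 - k) / k).
Proof.
move=> k0 k1; rewrite Gamma_1B// /Gamma.
have -> : Num.truncn (1 - - k) = 1%N.
  by apply/truncn_def; rewrite opprK lerDl (ltW k0)/= -natr1 ltrD2l.
rewrite big_ord1 addr0 invrN mulrN /Rintegral.
by under eq_integral do rewrite addrAC subrK.
Qed.

End tonelli_gamma.

(** * Independence of the order of the differences *)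

Section binomial_differences.
Context {R : realType}.
Notation mu := (@lebesgue_measure R).
Notation pos := (`]0%R, +oo[%classic : set R).

Let preimage_scale (c : R) : 0 < c -> (fun x => c * x + 0) @^-1` pos = pos.
Proof.
by move=> c0; apply/seteqP; split=> x /=; rewrite !in_itv/= !andbT addr0 pmulr_rgt0.
Qed.

Lemma ge0_integral_scale (c : R) (f : R -> \bar R) : 0 < c ->
  measurable_fun pos f -> (forall x, 0 < x -> (0 <= f x)%E) ->
  (\int[mu]_(t in pos) f (c * t)%R = c^-1%:E * \int[mu]_(t in pos) f t)%E.
Proof.
move=> c0 mf f0.
rewrite -(ge0_integral_affine 0 c0 _ mf)//; last first.
  by move=> x; rewrite /= in_itv/= andbT; exact: f0.
by rewrite preimage_scale//; apply: eq_integral => x _; rewrite addr0.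
Qed.

Let measurable_scale (c : R) (f : R -> \bar R) : 0 < c ->
  measurable_fun pos f -> measurable_fun pos (fun t => f (c * t)).
Proof.
move=> c0 mf; apply: (measurable_comp _ _ mf) => //.
by move=> _ [x /= + <-]; rewrite !in_itv/= !andbT => x0; rewrite mulr_gt0.
Qed.

Lemma integrable_scale (c : R) (f : R -> \bar R) : 0 < c ->
  mu.-integrable pos f -> mu.-integrable pos (fun t => f (c * t)).
Proof.
move=> c0 /integrableP[mf foo]; apply/integrableP; split.
  exact: measurable_scale.
rewrite (@ge0_integral_scale c (fun t => `|f t|%E))//; last first.
  exact: measurableT_comp.
by rewrite lte_mul_pinfty// lee_fin invr_ge0 ltW.
Qed.

Lemma integral_scale (c : R) (f : R -> \bar R) : 0 < c ->
  mu.-integrable pos f ->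
  (\int[mu]_(t in pos) f (c * t)%R = c^-1%:E * \int[mu]_(t in pos) f t)%E.
Proof.
move=> c0 fi; have mf := measurable_int mu fi.
rewrite integralE [in RHS]integralE muleBr//; last first.
  apply: fin_num_adde_defl; rewrite fin_numN.
  exact: integrable_neg_fin_num.
rewrite -(@ge0_integral_scale c (f^\+)%E)//; last exact: measurable_funepos.
rewrite -(@ge0_integral_scale c (f^\-)%E)//; last exact: measurable_funeneg.
by congr (_ - _)%E; apply: eq_integral => t _; rewrite ?funeposE ?funenegE.
Qed.

(** With H t = F t * t^(-k-1), the m-th term is m^(k+1) * H (m t), and the substitution t -> t / m
    takes back one factor m. The term m = 0 cannot be rescaled: it vanishes by F 0 = 0, in
    accordance with 0^k = 0. *)
Lemma integral_binomial_diff (k : R) (n : nat) (F : R -> R) : 0 < k ->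
  F 0 = 0 -> mu.-integrable pos (fun t => (F t * t `^ (- k - 1))%:E) ->
  (\int[mu]_(t in pos)
     ((\sum_(m < n.+1) (-1) ^+ m * 'C(n, m)%:R * F (m%:R * t)) *
      t `^ (- k - 1))%:E =
   (\sum_(m < n.+1) (-1) ^+ m * 'C(n, m)%:R * m%:R `^ k)%:E *
   \int[mu]_(t in pos) (F t * t `^ (- k - 1))%:E)%E.
Proof.
move=> k0 F0 iF.
pose H t : \bar R := (F t * t `^ (- k - 1))%:E.
have HE (m : nat) (t : R) : 0 < t ->
    ((F (m%:R * t) * t `^ (- k - 1))%:E = (m%:R * m%:R `^ k)%:E * H (m%:R * t)%R)%E.
  move=> t0; rewrite /H -EFinM; congr EFin.
  case: m => [|m]; first by rewrite !mul0r F0 mul0r.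
  have m0 : 0 < m.+1%:R :> R by [].
  rewrite powRM// ?(ltW t0)//.
  have -> : m.+1%:R `^ (- k - 1) = (m.+1%:R `^ k * m.+1%:R)^-1 :> R.
    by rewrite -opprD powRN powRD ?pnatr_eq0 ?implybT// powRr1.
  have mk0 : m.+1%:R `^ k != 0 :> R by rewrite gt_eqF// powR_gt0.
  by field; rewrite mk0 gt_eqF.
have iH (m : nat) : mu.-integrable pos (fun t => (F (m%:R * t) * t `^ (- k - 1))%:E).
  case: m => [|m].
    have -> : (fun t => (F (0%:R * t) * t `^ (- k - 1))%:E) = cst (0%E : \bar R).
      by apply/funext => t; rewrite mul0r F0 mul0r.
    exact: integrable0.
  have : mu.-integrable pos
      (fun t => ((m.+1%:R * m.+1%:R `^ k)%:E * H (m.+1%:R * t)%R)%E).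
    by apply: integrableZl => //; exact: integrable_scale.
  by apply: eq_integrable => // t; rewrite inE/= in_itv/= andbT => t0; rewrite HE.
have IH (m : nat) : (\int[mu]_(t in pos) (F (m%:R * t) * t `^ (- k - 1))%:E =
    (m%:R `^ k)%:E * \int[mu]_(t in pos) H t)%E.
  case: m => [|m].
    rewrite powR0 ?gt_eqF// mul0e.
    by rewrite integral0_eq// => t _; rewrite mul0r F0 mul0r.
  transitivity (\int[mu]_(t in pos) ((m.+1%:R * m.+1%:R `^ k)%:E * H (m.+1%:R * t)%R))%E.
    by apply: eq_integral => t; rewrite inE/= in_itv/= andbT => t0; rewrite HE.
  rewrite integralZl//; last exact: integrable_scale.
  rewrite integral_scale// muleA -EFinM.
  by congr (_%:E * _)%E; field.
transitivity (\int[mu]_(t in pos) \sum_(m < n.+1)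
    (((-1) ^+ m * 'C(n, m)%:R)%:E * (F (m%:R * t) * t `^ (- k - 1))%:E))%E.
  apply: eq_integral => t _; rewrite mulr_suml -sumEFin.
  by apply: eq_bigr => m _; rewrite -EFinM mulrA.
rewrite integral_sum//; last by move=> m; apply: integrableZl.
have Ifin : (\int[mu]_(t in pos) H t)%E \is a fin_num by exact: integrable_fin_num.
rewrite -(fineK Ifin) -EFinM mulr_suml -sumEFin.
apply: eq_bigr => m _.
by rewrite integralZl// IH -(fineK Ifin) -!EFinM mulrA.
Qed.

Lemma sum_sign_binomial (n : nat) : (0 < n)%N ->
  \sum_(m < n.+1) (-1) ^+ m * 'C(n, m)%:R = 0 :> R.
Proof.
move=> n0; transitivity ((1 - 1) ^+ n : R); last first.
  by rewrite subrr expr0n gtn_eqF.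
by rewrite exprBn; apply: eq_bigr => m _; rewrite !expr1n !mulr1 mulr_natr.
Qed.

(* Apply [integral_binomial_diff] to [F t = exp (- t) - 1], whose n-th
   difference [(1 - exp (- t)) ^+ n] is positive. *)
Lemma sum_binomial_powR_neq0 (k : R) (n : nat) : 0 < k -> k < 1 -> (0 < n)%N ->
  \sum_(m < n.+1) (-1) ^+ m * 'C(n, m)%:R * m%:R `^ k != 0 :> R.
Proof.
move=> k0 k1 n0; apply/eqP => S0.
pose F (t : R) := expR (- t) - 1.
have mexp D : measurable_fun D (fun t : R => expR (- t)).
  by apply: measurableT_comp; [exact: measurable_expR|exact: oppr_measurable].
have mF D : measurable_fun D (fun t : R => (F t * t `^ (- k - 1))%:E).
  apply/measurable_EFinP; apply: measurable_funM.
    exact: measurable_funB.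
  exact: measurable_funT_powR.
(* The bound 1 gives integrability against t^(-k-1) at infinity, where k > 0 is used, and the bound
   t gives it at 0, where k < 1 is used. *)
have Fle1 t : 0 < t -> `|F t| <= 1.
  move=> t0; rewrite ler0_norm; last first.
    by rewrite subr_le0 -expR0 ler_expR oppr_le0 ltW.
  by rewrite opprB gerBl expR_ge0.
have Flet t : 0 < t -> `|F t| <= t.
  move=> t0; rewrite ler0_norm; last first.
    by rewrite subr_le0 -expR0 ler_expR oppr_le0 ltW.
  by rewrite opprB lerBlDr -lerBlDl; apply: le_trans (expR_ge1Dx _).
have mnF D : measurable_fun D (fun t : R => `|(F t * t `^ (- k - 1))%:E|%E).
  by apply: measurableT_comp => //; exact: mF.
have iF : mu.-integrable pos (fun t => (F t * t `^ (- k - 1))%:E).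
  apply/integrableP; split; first exact: mF.
  rewrite (@ge0_integral_split _ 1); [|exact: ltr01|exact: mnF|by move=> t _; exact: abse_ge0].
  apply: lte_add_pinfty.
    have := @integral_powR_lty R (1 - k) 1; rewrite subr_gt0 => /(_ k1).
    apply: le_lt_trans; apply: ge0_le_integral => //.
    - exact: mnF.
    - by apply/measurable_EFinP; exact: measurable_funT_powR.
    - move=> t; rewrite /= in_itv/= => /andP[t0 _]; rewrite lee_fin.
      rewrite normrM [X in _ * X]ger0_norm ?powR_ge0//.
      have -> : 1 - k - 1 = 1 + (- k - 1) :> R by rewrite addrA.
      rewrite [leRHS]powRD ?(gt_eqF t0) ?implybT// powRr1 ?(ltW t0)//.
      by rewrite ler_wpM2r ?powR_ge0 ?Flet.
  apply: (@le_lt_trans _ _ (\int[mu]_(t in `]1%R, +oo[) (t `^ (- k - 1))%:E)%E); last first.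
    by rewrite integral_powR_tail// ltry.
  apply: ge0_le_integral => //.
  - exact: mnF.
  - by apply/measurable_EFinP; exact: measurable_funT_powR.
  - move=> t; rewrite /= in_itv/= andbT => t1; rewrite lee_fin.
    rewrite normrM [X in _ * X]ger0_norm ?powR_ge0//.
    by rewrite ler_piMl ?powR_ge0// Fle1// (lt_trans _ t1).
have F0 : F 0 = 0 by rewrite /F oppr0 expR0 subrr.
have := integral_binomial_diff n k0 F0 iF.
rewrite S0 mul0e => I0.
have : (0 < \int[mu]_(t in pos)
     ((\sum_(m < n.+1) (-1) ^+ m * 'C(n, m)%:R * F (m%:R * t)) *
      t `^ (- k - 1))%:E)%E; last by rewrite I0 ltxx.
have diffE t : \sum_(m < n.+1) (-1) ^+ m * 'C(n, m)%:R * F (m%:R * t) =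
    (1 - expR (- t)) ^+ n.
  rewrite exprBn; under eq_bigr do rewrite mulrBr mulr1.
  rewrite sumrB sum_sign_binomial// subr0; apply: eq_bigr => m _.
  by rewrite expr1n mulr1 -expRM_natl mulrN -[RHS]mulr_natr mulrAC.
under eq_integral do rewrite diffE.
have mD D : measurable_fun D (fun t : R => ((1 - expR (- t)) ^+ n * t `^ (- k - 1))%:E).
  apply/measurable_EFinP; apply: measurable_funM; last exact: measurable_funT_powR.
  apply: measurable_funX; exact: measurable_funB.
have D0 t : 0 < t -> 0 <= 1 - expR (- t).
  by move=> t0; rewrite subr_ge0 -expR0 ler_expR oppr_le0 ltW.
(* On ]1, 2[ the integrand stays above the positive constant (1 - exp(-1))^n * 2^(-k-1). *)
apply: (@lt_le_trans _ _ (\int[mu]_(t in `]1%R, 2%R[)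
    ((1 - expR (- 1)) ^+ n * 2 `^ (- k - 1))%:E)%E).
  rewrite integral_cst//= lebesgue_measure_itv/= lte_fin ltr1n/=.
  by rewrite -EFinB -EFinM lte_fin mulr_gt0 ?subr_gt0 ?ltr1n//.
apply: (@le_trans _ _ (\int[mu]_(t in `]1%R, 2%R[)
    ((1 - expR (- t)) ^+ n * t `^ (- k - 1))%:E)%E).
  apply: ge0_le_integral => //.
  - exact: mD.
  - move=> t; rewrite /= in_itv/= => /andP[t1 t2].
    have t0 := lt_trans ltr01 t1.
    rewrite lee_fin ler_pM ?powR_ge0 ?exprn_ge0 ?D0//.
      by rewrite lerXn2r ?nnegrE ?D0// lerD2l lerN2 ler_expR lerN2 ltW.
    by rewrite -opprD ler_powRN ?(ltW t2)// addr_ge0 ?ltW.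
apply: ge0_subset_integral => //.
- exact: mD.
- move=> t; rewrite /= in_itv/= andbT => t0.
  by rewrite lee_fin mulr_ge0 ?powR_ge0// exprn_ge0// D0.
- by move=> t; rewrite /= !in_itv/= andbT => /andP[t1 _]; exact: lt_trans t1.
Qed.

End binomial_differences.

(** * The associated norm *)

Section associate_norm.
Context {R : realType}.
Notation mu := (@lebesgue_measure R).
Implicit Types (G A : set R) (E : set (R -> R)) (N : (R -> R) -> R) (f g : R -> R).

Definition line_or_halfline G := G = [set: R] \/ G = [set` `[0, +oo[].

Lemma measurable_line_or_halfline G : line_or_halfline G -> measurable G.
Proof. by move=> [->|->]. Qed.

Lemma ge0_line_or_halfline G x : line_or_halfline G -> 0 <= x -> G x.
Proof. by move=> [->|->]//= x0; rewrite in_itv/= andbT. Qed.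

Lemma addr_line_or_halfline G x y : line_or_halfline G -> G x -> 0 <= y -> G (y + x).
Proof.
move=> [->|->]//=; rewrite !in_itv/= !andbT => x0 y0; exact: addr_ge0.
Qed.

Lemma lattice_norm E G N f : ideal_lattice G E N -> E f ->
  E (fun x => `|f x|) /\ N (fun x => `|f x|) <= N f.
Proof.
move=> hE Ef; apply: (il_ideal hE Ef).
  by apply: measurableT_comp => //; exact: (il_measurable hE Ef).
by apply: aeW => x _; rewrite normr_id.
Qed.

Lemma lattice_shift E G N f x : line_or_halfline G ->
  semi_shift_invariant G E N -> E f -> G x ->
  E (fun y => f (y + x)) /\ N (fun y => f (y + x)) <= N f.
Proof.
move=> hG hs Ef Gx; have [Efx NT N0] := hs f x Ef Gx; split => //.
by case: hG => GE; [rewrite NT|exact: N0].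
Qed.

Lemma assoc_norm_ge0 G E N g : ideal_lattice G E N -> (0 <= assoc_norm G E N g)%E.
Proof.
move=> hE; apply: ereal_sup_ubound; exists (cst 0).
  split; first exact: il_0 hE.
  have := il_norm_scale hE 0 (il_0 hE).
  have -> : (fun x : R => 0 * cst 0 x) = cst 0 :> (R -> R).
    by apply/funext => x; rewrite mul0r.
  by rewrite normr0 mul0r => ->.
by rewrite integral0_eq// => x _; rewrite /= mul0r.
Qed.

(** For nonnegative [g] the signed integrals in the supremum are dominated by those with |f|, so
    nonnegative integrands suffice. *)
Lemma assoc_norm_le G E N g (C : \bar R) :
  measurable G -> ideal_lattice G E N -> measurable_fun G g ->
  (forall x, G x -> 0 <= g x) ->
  (forall f, E f -> N f <= 1 ->
    (\int[mu]_(x in G) (`|f x| * g x)%:E <= C)%E) ->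
  (assoc_norm G E N g <= C)%E.
Proof.
move=> mG hE mg g0 fC; apply: ge_ereal_sup => _ [f [Ef Nf] <-].
apply: le_trans (fC f Ef Nf); apply: le_trans (lee_abs _) _.
apply: le_trans (le_abse_integral _ _ _) _ => //.
  by apply/measurable_EFinP; apply: measurable_funM => //; exact: (il_measurable hE Ef).
apply: ge0_le_integral => //.
- apply: measurableT_comp => //; apply/measurable_EFinP; apply: measurable_funM => //.
  exact: (il_measurable hE Ef).
- apply/measurable_EFinP; apply: measurable_funM => //.
  by apply: measurableT_comp => //; exact: (il_measurable hE Ef).
- by move=> x Gx; rewrite abse_EFin lee_fin normrM (ger0_norm (g0 _ Gx)).
Qed.

Lemma le_assoc_norm G E N f g : ideal_lattice G E N -> E f -> N f <= 1 ->
  (\int[mu]_(x in G) (`|f x| * g x)%:E <= assoc_norm G E N g)%E.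
Proof.
move=> hE Ef Nf; have [Eaf Naf] := lattice_norm hE Ef.
apply: ereal_sup_ubound; exists (fun x => `|f x|) => //.
by split => //; exact: le_trans Nf.
Qed.

(** Hölder's inequality for E and E^1, by testing the supremum on f / N f. *)
Lemma integral_le_assoc_norm G E N f g :
  measurable G -> ideal_lattice G E N -> measurable_fun G g ->
  (forall x, G x -> 0 <= g x) -> E f ->
  (\int[mu]_(x in G) (`|f x| * g x)%:E <= assoc_norm G E N g * (N f)%:E)%E.
Proof.
move=> mG hE mg g0 Ef; have mf := il_measurable hE Ef.
have maf : measurable_fun G (fun x => `|f x|) by exact: measurableT_comp.
(* Here [f] cannot be normalised, but it vanishes a.e.; the right-hand side is 0 even if the
   associated norm is +oo. *)
have [Nf0|Nf0] := eqVneq (N f) 0.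
  rewrite Nf0 mule0 (ae_eq_integral (cst 0%E)) ?integral0//.
    by apply/measurable_EFinP; exact: measurable_funM.
  have := il_norm_eq0 hE Ef Nf0.
  by apply: filterS => x /= fx Gx; rewrite fx// normr0 mul0r.
have {}Nf0 : 0 < N f by rewrite lt_neqAle eq_sym Nf0 (il_norm_ge0 hE).
have Ef' := il_scale hE (N f)^-1 Ef.
have Nf' : N (fun x => (N f)^-1 * f x) <= 1.
  rewrite (il_norm_scale hE)// ger0_norm ?invr_ge0 ?(ltW Nf0)//.
  by rewrite mulVf ?(gt_eqF Nf0).
have := le_assoc_norm g hE Ef' Nf'.
rewrite muleC -lee_pdivrMl//; apply: le_trans.
rewrite -ge0_integralZl_EFin//.
- apply: ge0_le_integral => //.
  + by move=> x Gx; rewrite -EFinM lee_fin !mulr_ge0 ?g0// invr_ge0 ltW.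
  + apply/measurable_EFinP; apply: measurable_funM => //; exact: measurable_funM.
  + apply/measurable_EFinP; apply: measurable_funM => //.
    by apply: measurableT_comp => //; exact: measurable_funM.
  + move=> x Gx; rewrite -EFinM lee_fin normrM mulrA ger0_norm// invr_ge0 ltW//.
- by move=> x Gx; rewrite lee_fin mulr_ge0// g0.
- by apply/measurable_EFinP; exact: measurable_funM.
- by rewrite invr_ge0 ltW.
Qed.

Lemma measurable_tau (k h : R) D : measurable D -> measurable_fun D (tau k h).
Proof.
move=> mD; apply: measurable_funTS.
have -> : tau k h = (fun x => x `^ (- k) - h `^ (- k)) \_ `]0, h[.
  by apply/funext => x; rewrite /tau patchE mem_setE.
apply/(measurable_restrictT _ (measurable_itv _)).
by apply: measurable_funB => //; exact: measurable_funT_powR.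
Qed.

Lemma tau_ge0 (k h x : R) : 0 < k -> 0 <= tau k h x.
Proof.
move=> k0; rewrite /tau; case: ifPn => //; rewrite in_itv/= => /andP[x0 xh].
by rewrite subr_ge0 ler_powRN// ltW.
Qed.

Lemma integral_tau G (k h : R) (w : R -> R) : line_or_halfline G ->
  (\int[mu]_(x in G) (w x * tau k h x)%:E =
   \int[mu]_(x in `]0%R, h[) (w x * (x `^ (- k) - h `^ (- k)))%:E)%E.
Proof.
move=> hG; rewrite integral_mkcond [RHS]integral_mkcond.
apply: eq_integral => x _; rewrite !patchE /tau mem_setE.
case: (boolP (x \in `]0, h[)) => [xh|_]; last by case: ifPn => // _; rewrite ?mulr0.
rewrite mem_set//; apply: ge0_line_or_halfline => //.
by move: xh; rewrite in_itv/= => /andP[/ltW].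
Qed.

(* The singularity of the weight is only seen by ]0, 1[; on ]1, m[ the weight
   decreases, so that shifting f by 1 reduces the claim for m + 1 to that for m. *)
Lemma integral_powR_lattice_le G E N (k : R) (m : nat) f : line_or_halfline G ->
  ideal_lattice G E N -> semi_shift_invariant G E N -> 0 < k -> E f -> N f <= 1 ->
  (\int[mu]_(x in `]0%R, m%:R[) (`|f x| * x `^ (- k))%:E <=
   m%:R%:E * assoc_norm G E N (cut_power k 1))%E.
Proof.
move=> hG hE hs k0; have mG := measurable_line_or_halfline hG.
have mfk g D : E g -> measurable D -> D `<=` G ->
    measurable_fun D (fun x => (`|g x| * x `^ (- k))%:E).
  move=> Eg mD DG; apply/measurable_EFinP.
  apply: measurable_funM; last exact: measurable_funT_powR.
  apply: measurableT_comp => //; apply: measurable_funS DG _ => //.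
  exact: (il_measurable hE Eg).
have posG a b : 0 <= a -> `]a, b[%classic `<=` G.
  move=> a0 x /=; rewrite in_itv/= => /andP[ax _].
  by apply: ge0_line_or_halfline => //; exact: ltW (le_lt_trans a0 ax).
elim: m f => [|m IH] f Ef Nf.
  by rewrite set_itvoo0 integral_set0 mul0e.
have m1 : 1 <= m.+1%:R :> R by rewrite ler1n.
have -> : (`]0, m.+1%:R[ = `]0, 1[ `|` `[1, m.+1%:R[ :> set R)%classic.
  by apply: itv_bndbnd_setU; rewrite bnd_simp.
rewrite ge0_integral_setU//; last 3 first.
- by rewrite -itv_bndbnd_setU ?bnd_simp//; apply: mfk => //; exact: posG.
- by move=> x _; rewrite lee_fin mulr_ge0 ?powR_ge0.
- by apply/disj_setPS => x [/=]; rewrite !in_itv/= => /andP[_ x1] /andP[]; rewrite leNgt x1.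
rewrite -natr1 EFinD ge0_muleDl ?lee_fin// mul1e addeC leeD//.
- have [Ef1 Nf1] := lattice_shift hG hs Ef (ge0_line_or_halfline hG (@ler01 R)).
  apply: le_trans (IH _ Ef1 (le_trans Nf1 Nf)).
  rewrite -integral_itv_obnd_cbnd; last by apply: mfk => //; exact: posG.
  have := @ge0_integral_affine R 1 1 `]1, (m%:R + 1)[%classic
    (fun x => (`|f x| * x `^ (- k))%:E) ltr01 (measurable_itv _)
    (mfk _ _ Ef (measurable_itv _) (posG _ _ ler01)).
  rewrite invr1 mul1e => <-; last by move=> x _; rewrite lee_fin mulr_ge0 ?powR_ge0.
  have -> : (fun x : R => 1 * x + 1) @^-1` `]1, m%:R + 1[%classic = `]0, m%:R[%classic.
    by apply/seteqP; split => x /=; rewrite !in_itv/= mul1r ltrD2r ltrDr.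
  apply: ge0_le_integral => //.
  + by move=> x _; rewrite lee_fin mulr_ge0 ?powR_ge0.
  + apply/measurable_EFinP; apply: measurable_funM.
      apply: measurableT_comp => //; apply: measurable_funS (posG 0 _ _) _ => //.
      by under eq_fun do rewrite mul1r; exact: (il_measurable hE Ef1).
    apply: (measurableT_comp (measurable_powR _)) => //.
    apply: measurable_funD => //; exact: mulrl_measurable.
  + by apply: mfk => //; exact: posG.
  + move=> x; rewrite /= in_itv/= => /andP[x0 _]; rewrite mul1r lee_fin ler_wpM2l//.
    by rewrite ler_powRN ?(ltW k0)// lerDl.
- apply: le_trans (le_assoc_norm (cut_power k 1) hE Ef Nf).
  rewrite integral_mkcond [leRHS]integral_mkcond.
  rewrite le_eqVlt; apply/orP; left; apply/eqP; apply: eq_integral => x _.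
  rewrite !patchE /cut_power indicE.
  case: (boolP (x \in `]0, 1[%classic)) => [x01|_]; last first.
    by case: ifPn => // _; rewrite !mulr0.
  by rewrite mulr1 mem_set//; apply: (posG 0 1) => //; exact: set_mem.
Qed.

(** On ]0, h[ the weight is at most x^-k. With an integer m > h, the interval lies in ]0, m[, where
    x^-k costs m times the norm of its part on ]0, 1[. *)
Lemma assoc_norm_tau_lty G E N (k h : R) : line_or_halfline G ->
  ideal_lattice G E N -> semi_shift_invariant G E N -> 0 < k -> 
  (assoc_norm G E N (cut_power k 1) < +oo)%E -> (assoc_norm G E N (tau k h) < +oo)%E.
Proof.
move=> hG hE hs k0 cy; have mG := measurable_line_or_halfline hG.
pose m := (Num.truncn h).+1.
have hm : h < m%:R by exact: truncnS_gt.
apply: (@le_lt_trans _ _ (m%:R%:E * assoc_norm G E N (cut_power k 1))%E); last first.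
  by apply: lte_mul_pinfty => //; rewrite lee_fin.
apply: assoc_norm_le => //.
- exact: measurable_tau.
- by move=> x _; exact: tau_ge0.
move=> f Ef Nf.
apply: le_trans (integral_powR_lattice_le m hG hE hs k0 Ef Nf).
have posG a : `]0, a[%classic `<=` G.
  move=> x /=; rewrite in_itv/= => /andP[x0 _].
  by apply: ge0_line_or_halfline => //; exact: ltW.
have mf (a : R) : measurable_fun (`]0, a[%classic : set R) (fun x => `|f x|).
  by apply: measurableT_comp => //; apply: measurable_funS (posG _) _ => //; exact: (il_measurable hE Ef).
rewrite integral_tau//.
apply: (@le_trans _ _ (\int[mu]_(x in `]0%R, h[) (`|f x| * x `^ (- k))%:E)%E).
  apply: ge0_le_integral => //.
  - move=> x; rewrite /= in_itv/= => /andP[x0 xh].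
    by rewrite lee_fin mulr_ge0// subr_ge0 ler_powRN// ltW.
  - apply/measurable_EFinP; apply: measurable_funM; first exact: mf.
    by apply: measurable_funB => //; exact: measurable_funT_powR.
  - by apply/measurable_EFinP; apply: measurable_funM; [exact: mf|exact: measurable_funT_powR].
  - by move=> x _; rewrite lee_fin ler_wpM2l// gerBl powR_ge0.
apply: ge0_subset_integral => //.
- by apply/measurable_EFinP; apply: measurable_funM; [exact: mf|exact: measurable_funT_powR].
- by move=> x _; rewrite lee_fin mulr_ge0 ?powR_ge0.
- by move=> x; rewrite /= !in_itv/= => /andP[->/= xh]; exact: lt_trans hm.
Qed.

(* Otherwise all of E vanishes a.e. on ]0, h[, so that A may be taken disjoint
   from ]0, h[; but the power function, which is not 0 there, is in E^1. *)
Lemma assoc_norm_tau_gt0 G E N A (k h : R) : line_or_halfline G ->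
  ideal_lattice G E N -> is_support G E A -> 0 < k -> 0 < h ->
  assoc_space G E N A (cut_power k 1) -> (0 < assoc_norm G E N (tau k h))%E.
Proof.
move=> hG hE [[mA AG Evanish] Amin] k0 h0 [_ supp _].
have mG := measurable_line_or_halfline hG.
rewrite lt_neqAle assoc_norm_ge0// andbT; apply/eqP => tau0.
(* If the norm is 0, the integral of |f| * [tau] is 0 for every [f] in [E]. Since [tau] is positive
   on ]0, h[, [f] vanishes a.e. there, so A \ ]0, h[ carries [E] too. *)
have Evanish' f : E f -> {ae mu, forall x, G x -> ~ (A `\` `]0, h[) x -> f x = 0}.
  move=> Ef.
  have mft : measurable_fun G (fun x => (`|f x| * tau k h x)%:E).
    apply/measurable_EFinP; apply: measurable_funM; last exact: measurable_tau.
    by apply: measurableT_comp => //; exact: (il_measurable hE Ef).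
  have ft0 x : (0 <= (`|f x| * tau k h x)%:E)%E.
    by rewrite lee_fin mulr_ge0 ?tau_ge0.
  have : (\int[mu]_(x in G) `|(`|f x| * tau k h x)%:E| = 0)%E.
    apply/eqP; rewrite eq_le; apply/andP; split; last exact: integral_ge0.
    under eq_integral do rewrite gee0_abs//.
    have := integral_le_assoc_norm mG hE (measurable_tau k h mG) (fun x _ => tau_ge0 h x k0) Ef.
    by rewrite -tau0 mul0e.
  move/(ae_eq_integral_abs mu mG mft) => ft.
  apply: filterS2 (Evanish f Ef) ft; first exact: (ae_filter_ringOfSetsType mu).
  move=> x fA ftx Gx nAh.
  have [Ax|/(fA Gx)//] := pselect (A x).
  have xh : x \in `]0, h[.
    by apply: contrapT => /negP nxh; apply: nAh; split => //; exact/negP.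
  have := ftx Gx; rewrite /= /tau xh => -[/eqP]; rewrite mulf_eq0 normr_eq0.
  case/orP => [/eqP//|]; rewrite subr_eq0 => /eqP E0.
  move: xh; rewrite in_itv/= => /andP[x0 xh].
  have : h `^ (- k) < x `^ (- k).
    rewrite !powRN ltf_pV2 ?posrE ?powR_gt0//.
    by rewrite gt0_ltr_powR// nnegrE ltW.
  by rewrite E0 ltxx.
have A0 : mu (A `&` `]0, h[) = 0%E.
  have := Amin (A `\` `]0, h[) => <-.
    by rewrite setDD.
  split => //; first exact: measurableD.
  by move=> x [/AG].
(* On ]0, m[ the function [cut_power k 1] is positive, while almost every point there lies outside
   [A]. *)
pose m := Num.min 1 h.
have m0 : 0 < m by rewrite lt_min ltr01.
have notA0h : {ae mu, forall x, ~ (A `&` `]0, h[) x}.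
  exists (A `&` `]0, h[); split => //; first exact: measurableI.
  by move=> x /contrapT.
have suppA0h : {ae mu, forall x : R,
    (G x -> ~ A x -> cut_power k 1 x = 0) /\ ~ (A `&` `]0, h[) x}.
  apply: filterS2 supp notA0h; first exact: (ae_filter_ringOfSetsType mu).
  by move=> x; split.
have [x /andP[x0 xm] [suppx nAh]] := ae_itv_witness m0 suppA0h.
move: xm; rewrite lt_min => /andP[x1 xh].
have Gx : G x by apply: ge0_line_or_halfline => //; exact: ltW.
apply: nAh; split; last by rewrite /= in_itv/= x0.
apply: contrapT => /(suppx Gx)/eqP.
rewrite /cut_power indicE mem_set/= ?mulr1 ?gt_eqF ?powR_gt0//.
by rewrite in_itv/= x0.
Qed.

End associate_norm.

(** * The upper bound *)

Section marchaud_bound.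
Context {R : realType}.
Notation mu := (@lebesgue_measure R).
Notation pos := (`]0%R, +oo[%classic : set R).
Implicit Types (G : set R) (E : set (R -> R)) (N : (R -> R) -> R).

(** Outside [G] the restricted function is 0, where the bound reads 0 <= y. *)
Lemma Linfty_norm_le G (f : R -> \bar R) (y : \bar R) : (0 <= y)%E ->
  (Linfty_norm G f <= y)%E <-> {ae mu, forall x, G x -> (`|f x| <= y)%E}.
Proof.
move=> y0; rewrite /Linfty_norm unlock /Lnorm.
(* The norm of exponent +oo is an essential supremum only on a space of positive measure. *)
have -> : (0 < mu [set: R])%E.
  by rewrite -set_itvNyy lebesgue_measure_itv/= ltry.
split=> [/ess_supP|fy].
  apply: filterS => x /= fy Gx; move: fy; rewrite patchE mem_set//.
apply/ess_supP; apply: filterS fy; first exact: (ae_filter_ringOfSetsType mu).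
move=> x fy /=.
by rewrite patchE; case: ifPn => [/set_mem/fy//|_]; rewrite abse0.
Qed.

Lemma Linfty_norm_ge0 G (f : R -> \bar R) : (0 <= Linfty_norm G f)%E.
Proof. exact: Lnorm_ge0. Qed.

(** The integral is moved to ]0, t[, so that its integrand is a shift of [df], to which semi
    shift-invariance applies. *)
Lemma increment_le_integral G E (f df : R -> R) (x t : R) :
  line_or_halfline G -> measurable_fun G df -> L1infty G E f df -> G x -> 0 <= t ->
  (`|f (t + x) - f x|%:E <= \int[mu]_(s in `]0%R, t[) `|df (s + x)|%:E)%E.
Proof.
move=> hG mdf [_ _ acf _ dfE] Gx t0.
have xt : x <= t + x by rewrite lerDr.
have Gxt : [set` `[x, t + x]] `<=` G.
  move=> y /=; rewrite in_itv/= => /andP[xy _].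
  by rewrite -(subrK x y); apply: addr_line_or_halfline; rewrite ?subr_ge0.
have Gxt' : `]x, (t + x)[%classic `<=` G.
  by apply: subset_trans Gxt; exact: subset_itv_oo_cc.
have mdf' : measurable_fun (`]x, (t + x)[%classic : set R) df.
  exact: measurable_funS (measurable_line_or_halfline hG) Gxt' mdf.
have dfE' : {ae mu, forall y, y \in `]x, (t + x)[ -> is_derive y 1 f (df y)}.
  apply: filterS dfE; first exact: (ae_filter_ringOfSetsType mu).
  by move=> y dfy xy; apply: dfy; exact: Gxt'.
apply: (le_trans (abs_continuous_le_integral xt (acf _ _ xt Gxt) mdf' dfE')).
have := @ge0_integral_affine R 1 x `]x, (t + x)[%classic (fun y => `|df y|%:E) ltr01
  (measurable_itv _).
rewrite invr1 mul1e => <- //; last first.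
  by apply/measurable_EFinP; exact: measurableT_comp.
have -> : (fun y : R => 1 * y + x) @^-1` `]x, t + x[%classic = `]0, t[%classic.
  by apply/seteqP; split => y /=; rewrite !in_itv/= mul1r ltrD2r ltrDr.
by under eq_integral do rewrite mul1r.
Qed.

Lemma measurable_shift_pos G (f : R -> R) x : line_or_halfline G ->
  measurable_fun G f -> G x -> measurable_fun pos (fun t => f (t + x)).
Proof.
move=> hG mf Gx; apply: (measurable_comp (measurable_line_or_halfline hG) _ mf).
  move=> _ [y /= + <-]; rewrite in_itv/= andbT => /ltW y0.
  exact: addr_line_or_halfline.
exact: measurable_funD.
Qed.

(** The absolute value stays under the integral so that the bound also supplies the convergence
    required by [marchaudE]. *)
Lemma integral_increment_le G E N (k h M : R) (f df : R -> R) (x : R) :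
  line_or_halfline G -> ideal_lattice G E N -> semi_shift_invariant G E N ->
  0 < k -> 0 < h -> L1infty G E f df -> G x -> 0 <= M ->
  `|f x| <= M -> {ae mu, forall y, G y -> `|f y| <= M} ->
  (\int[mu]_(t in pos) `|((f x - f (t + x)) * t `^ (- k - 1))%:E| <=
   (k^-1)%:E * (assoc_norm G E N (tau k h) * (N df)%:E +
                (2 * M * h `^ (- k))%:E))%E.
Proof.
move=> hG hE hs k0 h0 fdf Gx M0 fxM fM.
have mG := measurable_line_or_halfline hG.
have [mf _ _ Edf _] := fdf.
have mdf := il_measurable hE Edf.
have mF (D : set R) : measurable D -> D `<=` pos ->
    measurable_fun D (fun t => (`|((f x - f (t + x)) * t `^ (- k - 1))%:E|)%E).
  move=> mD Dpos; apply: measurableT_comp => //; apply/measurable_EFinP.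
  apply: measurable_funM; last exact: measurable_funT_powR.
  apply: measurable_funB => //.
  exact: (measurable_funS (measurable_itv _) Dpos (measurable_shift_pos hG mf Gx)).
have fxh0 : `]0, h[%classic `<=` pos.
  by move=> t; rewrite /= !in_itv/= andbT => /andP[].
have fxh1 : `]h, +oo[%classic `<=` pos.
  by move=> t; rewrite /= !in_itv/= !andbT; exact: lt_trans.
rewrite (ge0_integral_split h0); [|exact: mF|by move=> t _; exact: abse_ge0].
(* The shift does not increase the norm, which makes the bound uniform in [x]. *)
have [Edfx Ndfx] := lattice_shift hG hs Edf Gx.
rewrite ge0_muleDr; last 2 first.
- by rewrite mule_ge0 ?assoc_norm_ge0// lee_fin (il_norm_ge0 hE).
- by rewrite lee_fin !mulr_ge0 ?powR_ge0.
have mdfx : measurable_fun pos (fun s => `|df (s + x)|).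
  by apply: measurableT_comp => //; exact: measurable_shift_pos mdf Gx.
apply: leeD.
  apply: (@le_trans _ _ (\int[mu]_(t in `]0%R, h[)
      ((t `^ (- k - 1))%:E * \int[mu]_(s in `]0%R, t[) `|df (s + x)|%:E))%E).
    apply: ge0_le_integral => //.
    - exact: mF.
    - apply: emeasurable_funM.
        by apply/measurable_EFinP; exact: measurable_funT_powR.
      apply: measurable_primitive => //.
      exact: (measurable_funS (measurable_itv _) fxh0 mdfx).
    - move=> t; rewrite /= in_itv/= => /andP[t0 th].
      rewrite normrM [X in _ * X]ger0_norm ?powR_ge0// mulrC EFinM.
      rewrite lee_wpmul2l ?lee_fin ?powR_ge0// distrC.
      by apply: (increment_le_integral hG mdf fdf Gx); exact: ltW.
  rewrite integral_powR_primitive//; last exact: measurable_funS mdfx.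
  rewrite lee_pmul2l ?lte_fin ?invr_gt0//.
  rewrite -(integral_tau _ _ _ hG).
  apply: le_trans (integral_le_assoc_norm mG hE (measurable_tau k h mG) _ Edfx) _.
    by move=> s _; exact: tau_ge0.
  by rewrite lee_wpmul2l ?assoc_norm_ge0// lee_fin.
apply: (@le_trans _ _ (\int[mu]_(t in `]h, +oo[) ((2 * M)%:E * (t `^ (- k - 1))%:E))%E).
  apply: ae_ge0_le_integral => //.
  - exact: mF.
  - by move=> t _; rewrite -EFinM lee_fin !mulr_ge0 ?powR_ge0.
  - by apply/measurable_EFinP; apply: measurable_funM => //; exact: measurable_funT_powR.
  - have fM' := ae_lebesgue_translation x fM.
    apply: filterS fM'; first exact: (ae_filter_ringOfSetsType mu).
    move=> t ftM; rewrite /= in_itv/= andbT => ht.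
    have t0 := ltW (lt_trans h0 ht).
    rewrite -EFinM lee_fin normrM [X in _ * X]ger0_norm ?powR_ge0// ler_wpM2r ?powR_ge0//.
    apply: le_trans (ler_normB _ _) _.
    by rewrite mulr_natl mulr2n lerD// ftM//; exact: addr_line_or_halfline.
rewrite ge0_integralZl_EFin ?mulr_ge0//; last 2 first.
- by move=> t _; rewrite lee_fin powR_ge0.
- by apply/measurable_EFinP; exact: measurable_funT_powR.
rewrite integral_powR_tail// -!EFinM lee_fin.
rewrite le_eqVlt; apply/orP; left; apply/eqP; ring.
Qed.

(** The signed binomial coefficients sum to 0, so [f] may be replaced by F t = f (t + x) - f x,
    which vanishes at 0. The binomial sum then cancels against [varkappa] and leaves 1 / Gamma (-k)
    = - k / Gamma (1 - k), whatever [n] is. *)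
Lemma marchaudE G (k : R) (n : nat) (f : R -> R) (x : R) :
  line_or_halfline G -> measurable_fun G f -> G x -> 0 < k -> k < 1 -> (0 < n)%N ->
  (\int[mu]_(t in pos) `|((f x - f (t + x)) * t `^ (- k - 1))%:E| < +oo)%E ->
  (marchaud k n f x = (k / Gamma (1 - k))%:E *
    \int[mu]_(t in pos) ((f x - f (t + x)) * t `^ (- k - 1))%:E)%E.
Proof.
move=> hG mf Gx k0 k1 n0 Ioo.
pose F t := f (t + x) - f x.
have F0 : F 0 = 0 by rewrite /F add0r subrr.
have FE t : ((f x - f (t + x)) * t `^ (- k - 1) = -1 * (F t * t `^ (- k - 1)))%R.
  by rewrite /F mulN1r -mulNr opprB.
have iF : mu.-integrable pos (fun t => (F t * t `^ (- k - 1))%:E).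
  apply/integrableP; split.
    apply/measurable_EFinP; apply: measurable_funM; last exact: measurable_funT_powR.
    by apply: measurable_funB => //; exact: (measurable_shift_pos hG mf Gx).
  by move: Ioo; under eq_integral do rewrite FE EFinM abseM abse_EFin normrN1 mul1e.
have -> : (\int[mu]_(t in pos) ((f x - f (t + x)) * t `^ (- k - 1))%:E =
    (-1)%:E * \int[mu]_(t in pos) (F t * t `^ (- k - 1))%:E)%E.
  by rewrite -integralZl//; apply: eq_integral => t _; rewrite FE EFinM.
rewrite /marchaud.
have -> : (\int[mu]_(t in `]0%R, +oo[) (fwd_diff n t f x / t `^ (1 + k))%:E =
    \int[mu]_(t in pos) ((\sum_(m < n.+1) (-1) ^+ m * 'C(n, m)%:R * F (m%:R * t)) *
      t `^ (- k - 1))%:E)%E.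
  apply: eq_integral => t _.
  rewrite -opprD powRN [k + 1]addrC; congr (_ / _)%:E.
  transitivity (fwd_diff n t f x - (\sum_(m < n.+1) (-1) ^+ m * 'C(n, m)%:R) * f x).
    by rewrite sum_sign_binomial// mul0r subr0.
  rewrite /fwd_diff mulr_suml -sumrB; apply: eq_bigr => m _.
  by rewrite /F mulrBr [_ + x]addrC.
rewrite integral_binomial_diff// /varkappa GammaN//.
have S0 := sum_binomial_powR_neq0 k0 k1 n0.
set S := \sum_(m < n.+1) _ in S0 *.
rewrite !muleA -!EFinM; congr (_%:E * _)%E.
have G0 : Gamma (1 - k) != 0 by rewrite gt_eqF// Gamma_1B_gt0.
by field; rewrite S0 G0 gt_eqF.
Qed.

Lemma marchaud_le G E N (k h : R) (n : nat) (f df : R -> R) :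
  line_or_halfline G -> ideal_lattice G E N -> semi_shift_invariant G E N ->
  0 < k -> k < 1 -> (0 < n)%N -> 0 < h ->
  (assoc_norm G E N (tau k h) < +oo)%E -> L1infty G E f df ->
  (Linfty_norm G (marchaud k n f) <=
     (2 * h `^ (- k) / Gamma (1 - k))%:E * Linfty_norm G (EFin \o f)
     + (assoc_norm G E N (tau k h) * ((Gamma (1 - k))^-1)%:E) * (N df)%:E)%E.
Proof.
move=> hG hE hs k0 k1 n0 h0 tauoo fdf; have [mf foo _ Edf _] := fdf.
have Gam0 := Gamma_1B_gt0 k0 k1.
have /fineK fE : Linfty_norm G (EFin \o f) \is a fin_num.
  by rewrite ge0_fin_numE// Linfty_norm_ge0.
have /fineK tauE : assoc_norm G E N (tau k h) \is a fin_num.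
  by rewrite ge0_fin_numE// assoc_norm_ge0.
set M := fine (Linfty_norm G (EFin \o f)) in fE.
set T := fine (assoc_norm G E N (tau k h)) in tauE.
have M0 : 0 <= M by rewrite fine_ge0// Linfty_norm_ge0.
have T0 : 0 <= T by rewrite fine_ge0// assoc_norm_ge0.
have Ndf0 := il_norm_ge0 hE Edf.
rewrite -fE -tauE -!EFinM -EFinD.
apply/Linfty_norm_le.
  by rewrite lee_fin addr_ge0 ?mulr_ge0 ?powR_ge0 ?invr_ge0 ?(ltW Gam0).
have fM : {ae mu, forall y, G y -> `|f y| <= M}.
  have : (Linfty_norm G (EFin \o f) <= M%:E)%E by rewrite -fE.
  by move=> /Linfty_norm_le; apply; rewrite lee_fin.
apply: filterS (fM); first exact: (ae_filter_ringOfSetsType mu).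
move=> x fx Gx.
have bnd := integral_increment_le hG hE hs k0 h0 fdf Gx M0 (fx Gx) fM.
rewrite -tauE in bnd; rewrite -!(EFinM, EFinD) in bnd.
rewrite (marchaudE hG mf Gx k0 k1 n0); last exact: le_lt_trans bnd (ltry _).
have kG0 : 0 <= k / Gamma (1 - k) by exact: divr_ge0 (ltW k0) (ltW Gam0).
rewrite abseM gee0_abs ?lee_fin//.
apply: (@le_trans _ _ ((k / Gamma (1 - k))%:E * (k^-1 * (T * N df + 2 * M * h `^ (- k)))%:E)%E).
  rewrite lee_wpmul2l ?lee_fin//; apply: (le_trans _ bnd).
  apply: le_abse_integral => //; apply/measurable_EFinP.
  apply: measurable_funM; last exact: measurable_funT_powR.
  by apply: measurable_funB => //; exact: (measurable_shift_pos hG mf Gx).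
rewrite -EFinM lee_fin le_eqVlt; apply/orP; left; apply/eqP.
by field; rewrite !gt_eqF.
Qed.

End marchaud_bound.

(** * Sharpness *)

Section extremal.
Context {R : realType}.
Notation mu := (@lebesgue_measure R).
Notation pos := (`]0%R, +oo[%classic : set R).
Implicit Types (G : set R) (E : set (R -> R)) (N : (R -> R) -> R).

(* Boundedness of g makes its primitive Lipschitz; vanishing on ]0, x0] makes it
   constant near 0, so that a lower bound at 0 holds on a set of positive measure. *)
Lemma near_optimal_truncation G E N (k h C : R) :
  line_or_halfline G -> ideal_lattice G E N -> 0 < k -> 0 < h ->
  (C%:E < assoc_norm G E N (tau k h))%E ->
  exists (g : R -> R) (m x0 : R),
    [/\ 0 < x0 < h, measurable_fun [set: R] g /\ (forall x, 0 <= g x <= m),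
        (forall x, x \notin `]x0, h[ -> g x = 0), E g /\ N g <= 1 &
        (C%:E < \int[mu]_(s in `]0%R, h[) (g s * (s `^ (- k) - h `^ (- k)))%:E)%E].
Proof.
move=> hG hE k0 h0 /ereal_sup_gt[_ [w [Ew Nw] <-] Cw].
have mG := measurable_line_or_halfline hG.
have mw := il_measurable hE Ew.
have posG a b : 0 <= a -> `]a, b[%classic `<=` G.
  move=> a0 x /=; rewrite in_itv/= => /andP[ax _].
  by apply: ge0_line_or_halfline => //; exact: ltW (le_lt_trans a0 ax).
have {Cw} Cw : (C%:E < \int[mu]_(s in `]0%R, h[) (`|w s| * (s `^ (- k) - h `^ (- k)))%:E)%E.
  rewrite -(integral_tau _ _ _ hG); apply: (lt_le_trans Cw).
  have mwt : measurable_fun G (fun x => (w x * tau k h x)%:E).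
    by apply/measurable_EFinP; apply: measurable_funM => //; exact: measurable_tau.
  apply: le_trans (lee_abs _) _; apply: le_trans (le_abse_integral mu mG mwt) _.
  apply: ge0_le_integral => //.
  - exact: measurableT_comp.
  - apply/measurable_EFinP; apply: measurable_funM; last exact: measurable_tau.
    exact: measurableT_comp.
  - by move=> x Gx; rewrite abse_EFin lee_fin normrM (ger0_norm (tau_ge0 h x k0)).
(* Cut off at height n and away from 0, these functions increase to |w| on ]0, h[; by monotone
   convergence some n keeps the integral above [C]. *)
pose g n s : R := if s \in `]h / n.+2%:R, h[ then Num.min `|w s| n%:R else 0.
have hn n : 0 < h / n.+2%:R < h.
  by rewrite divr_gt0//= ltr_pdivrMr// ltr_pMr// ltr1n.
have hn0 n : 0 <= h / n.+2%:R by rewrite ltW//; have /andP[] := hn n.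
have mg n : measurable_fun [set: R] (g n).
  have -> : g n = (fun s => Num.min `|w s| n%:R) \_ `]h / n.+2%:R, h[.
    by apply/funext => s; rewrite /g patchE mem_setE.
  apply/(measurable_restrictT _ (measurable_itv _)).
  apply: measurable_minr => //; apply: measurableT_comp => //.
  exact: (measurable_funS mG (posG _ _ (hn0 n)) mw).
have g_ge0 n s : 0 <= g n s by rewrite /g; case: ifPn => // _; rewrite le_min normr_ge0 ler0n.
have g_le n s : g n s <= n%:R by rewrite /g; case: ifPn => // _; rewrite ge_min lexx orbT.
have gw n s : g n s <= `|w s| by rewrite /g; case: ifPn => // _; rewrite ge_min lexx.
have d_ge0 s : s \in `]0, h[ -> 0 <= s `^ (- k) - h `^ (- k).
  by rewrite in_itv/= => /andP[s0 sh]; rewrite subr_ge0 ler_powRN// ltW.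
have [n Cn] : exists n,
    (C%:E < \int[mu]_(s in `]0%R, h[) (g n s * (s `^ (- k) - h `^ (- k)))%:E)%E.
  apply: contrapT => /forallNP nC.
  have mono : (\int[mu]_(s in `]0%R, h[) (g n s * (s `^ (- k) - h `^ (- k)))%:E @[n --> \oo] -->
      \int[mu]_(s in `]0%R, h[) limn (fun n => (g n s * (s `^ (- k) - h `^ (- k)))%:E))%E.
    apply: cvg_monotone_convergence => //.
    - move=> n; apply/measurable_EFinP; apply: measurable_funM.
        exact: measurable_funTS (mg n).
      by apply: measurable_funB => //; exact: measurable_funT_powR.
    - by move=> n s sh; rewrite lee_fin mulr_ge0 ?d_ge0.
    - move=> s sh n p np; rewrite lee_fin ler_wpM2r ?d_ge0// /g.
      case: ifPn => [|_]; last by case: ifPn => // _; rewrite le_min normr_ge0 ler0n.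
      rewrite !in_itv/= => /andP[ns ->]; rewrite andbT.
      rewrite (le_lt_trans _ ns); last first.
        by rewrite ler_pM2l// lef_pV2 ?posrE// ler_nat !ltnS.
      by rewrite le_min ge_min lexx/= ge_min ler_nat np orbT.
  have : (\int[mu]_(s in `]0%R, h[) limn (fun n => (g n s * (s `^ (- k) - h `^ (- k)))%:E) <= C%:E)%E.
    rewrite -(cvg_lim (@ereal_hausdorff R) mono).
    apply: lime_le; first by apply/cvg_ex; eexists; exact: mono.
    by apply: nearW => n; rewrite leNgt; apply/negP/nC.
  apply/negP; rewrite -ltNge; apply: (lt_le_trans Cw).
  rewrite le_eqVlt; apply/orP; left; apply/eqP; apply: eq_integral => s.
  rewrite inE/= in_itv/= => /andP[s0 sh]; apply/esym/cvg_lim => //.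
  apply: cvg_near_cst; near=> n; congr (_ * _)%:E.
  have wn : `|w s| <= n%:R.
    apply: (@le_trans _ _ (Num.truncn `|w s|).+1%:R); first exact: ltW (truncnS_gt _).
    by rewrite ler_nat; near: n; exact: nbhs_infty_ge.
  rewrite /g in_itv/= sh andbT ltr_pdivrMr// mulrC -ltr_pdivrMr//.
  rewrite ifT; first by apply/min_idPl.
  apply: lt_le_trans (truncnS_gt _) _; rewrite ler_nat !ltnS.
  by apply: leqW; near: n; exact: nbhs_infty_ge.
exists (g n), n%:R, (h / n.+2%:R); split => //.
- by split => // x; rewrite g_ge0 g_le.
- by move=> x nx; rewrite /g (negbTE nx).
- have [] := il_ideal hE Ew (measurable_funTS (mg n)) => [|Eg Ng].
    by apply: aeW => x _; rewrite ger0_norm.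
  by split => //; exact: le_trans Nw.
Unshelve. all: by end_near. Qed.

(** Being bounded with bounded support, [g] is integrable on the line, so its primitive may start at
    -oo and is defined everywhere. *)
Lemma bounded_primitive (g : R -> R) (m x0 h : R) : 0 < x0 < h ->
  measurable_fun [set: R] g -> (forall x, 0 <= g x <= m) ->
  (forall x, x \notin `]x0, h[ -> g x = 0) ->
  exists P : R -> R,
    [/\ forall u v, u <= v -> 0 <= P v - P u <= m * (v - u),
        forall y, y <= x0 -> P y = 0,
        forall y, h <= y -> P y = P h,
        forall t, 0 < t -> ((P t)%:E = \int[mu]_(s in `]0%R, t[) (g s)%:E)%E &
        {ae mu, forall x : R, is_derive x 1 P (g x)}].
Proof.
move=> /andP[x00 x0h] mg gm gx0.
have g0 x : 0 <= g x by have /andP[] := gm x.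
have ig : mu.-integrable [set: R] (EFin \o g).
  have : mu.-integrable [set: R] (fun x => m%:E * (\1_[set` `]x0, h[] x)%:E)%E.
    by apply: integrableZl => //; exact: integrable_indic_itv.
  apply: le_integrable => //; first exact/measurable_EFinP.
  move=> x _; rewrite -EFinM /comp !abse_EFin lee_fin indicE (ger0_norm (g0 x)).
  have [xh|xh] := boolP (x \in `]x0, h[).
    by rewrite mem_set// mulr1 ler_normr; have /andP[_ ->] := gm x.
  by rewrite gx0.
have igS A : measurable A -> mu.-integrable A (EFin \o g).
  by move=> mA; exact: integrableS ig.
pose P y := \int[mu]_(t in [set` `]-oo, y]]) g t.
have PB u v : u <= v -> P v - P u = \int[mu]_(t in [set` `]u, v]]) g t.
  by move=> uv; rewrite /P Rintegral_itvB//; exact: igS.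
have int0 A : (forall x, A x -> g x = 0) -> \int[mu]_(t in A) g t = 0.
  by move=> A0; rewrite /Rintegral integral0_eq// => x Ax; rewrite A0.
have P0 y : y <= x0 -> P y = 0.
  move=> yx0; apply: int0 => x /=; rewrite in_itv/= => xy; apply: gx0.
  by rewrite in_itv/= ltNge (le_trans xy yx0).
exists P; split => //.
- move=> u v uv; rewrite PB//; apply/andP; split; first exact: Rintegral_ge0.
  have -> : m * (v - u) = \int[mu]_(t in [set` `]u, v]]) cst m t.
    rewrite Rintegral_cst//= lebesgue_measure_itv/= lte_fin.
    by case: ltP => [//|vu]; rewrite (_ : v = u) ?subrr//; apply/eqP; rewrite eq_le uv vu.
  apply: le_Rintegral => //.
  - exact: igS.
  - apply/integrableP; split; first by apply/measurable_EFinP.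
    have -> : (\int[mu]_(x in `]u, v]) `|(EFin \o cst m) x| = \int[mu]_(x in `]u, v]) cst `|m|%:E x)%E by [].
    rewrite (integral_cst mu (measurable_itv _))/= lebesgue_measure_itv/=.
    by case: ifPn => _; rewrite ?mule0// -EFinM ltry.
  - by move=> x _; have /andP[] := gm x.
- move=> y hy; apply/eqP; rewrite -subr_eq0 PB//; apply/eqP/int0 => x /=.
  rewrite in_itv/= => /andP[hx _]; apply: gx0; rewrite in_itv/= negb_and orbC.
  by rewrite -leNgt (ltW hx).
- move=> t t0; have -> : P t = P t - P 0 by rewrite (P0 0 (ltW x00)) subr0.
  rewrite PB ?(ltW t0)//.
  rewrite /Rintegral fineK; last by apply: integrable_fin_num => //; exact: igS.
  rewrite -(@integral_itv_bndo_bndc _ (BRight 0) t)//.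
  by apply/measurable_EFinP; exact: measurable_funTS.
- exact: ae_is_derive_primitive.
Qed.

End extremal.

Section sharpness.
Context {R : realType}.
Notation mu := (@lebesgue_measure R).
Notation pos := (`]0%R, +oo[%classic : set R).
Implicit Types (G : set R) (E : set (R -> R)) (N : (R -> R) -> R).

Lemma lipschitz_abs_continuous (a b m : R) (f : R -> R) : 0 <= m ->
  (forall u v, u <= v -> `|f v - f u| <= m * (v - u)) -> abs_continuous a b f.
Proof.
move=> m0 fm e e0; have m10 : 0 < m + 1 by rewrite ltr_wpDl.
(* Dividing by m + 1 covers the case m = 0. *)
exists (e / (m + 1)); first by rewrite divr_gt0.
move=> p u v auvb _; rewrite ltr_pdivlMr// mulrC; apply: le_lt_trans.
rewrite mulr_sumr; apply: ler_sum => i _; have [_ [uv _]] := auvb i.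
by apply: (le_trans (fm _ _ uv)); rewrite ler_wpM2r ?subr_ge0// lerDl.
Qed.

(** The upper limit on [e] makes the coefficient of N df nonnegative, so that N df <= 1 can be used
    on the smaller side. *)
Lemma marchaud_sharp G E N (k h e : R) (n : nat) :
  line_or_halfline G -> ideal_lattice G E N -> semi_shift_invariant G E N ->
  0 < k -> k < 1 -> (0 < n)%N -> 0 < h ->
  assoc_norm G E N (tau k h) \is a fin_num ->
  0 < e -> e <= fine (assoc_norm G E N (tau k h)) / Gamma (1 - k) ->
  exists f df : R -> R, L1infty G E f df /\
     ((2 * h `^ (- k) / Gamma (1 - k))%:E * Linfty_norm G (EFin \o f)
        + (assoc_norm G E N (tau k h) * ((Gamma (1 - k))^-1)%:E - e%:E)
            * (N df)%:E
      < Linfty_norm G (marchaud k n f))%E.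
Proof.
move=> hG hE hs k0 k1 n0 h0 /fineK tauE e0.
set T := fine (assoc_norm G E N (tau k h)) in tauE * => eT.
have Gam0 := Gamma_1B_gt0 k0 k1.
set Gam := Gamma (1 - k) in Gam0 eT *.
have mG := measurable_line_or_halfline hG.
(* Divided by [Gam], this level is T / Gam - e, the diminished constant of the claim. *)
have CT : ((T - Gam * e)%:E < assoc_norm G E N (tau k h))%E.
  by rewrite -tauE lte_fin gtrBl mulr_gt0.
have [g [m [x0 [x0h [mg gm] gx0 [Eg Ng]]]]] := near_optimal_truncation hG hE k0 h0 CT.
set J := (\int[mu]_(s in _) _)%E => CJ.
(* [J] is an extended real not known to be finite, so a real number is put between it and the level
   T - Gam * e. *)
have [r Cr rJ] : exists2 r, T - Gam * e < r & (r%:E <= J)%E.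
  move: CJ; case: J => [s|_|//]; first by rewrite lte_fin; exists s.
  by exists (T - Gam * e + 1); rewrite ?ltrDl ?leey.
have [P [PB P0 Ph PE dP]] := bounded_primitive x0h mg gm gx0.
have /andP[x00 x0h'] := x0h.
have g0 x : 0 <= g x by have /andP[] := gm x.
have m0 : 0 <= m by have /andP[/le_trans] := gm 0; apply.
have Pnd u v : u <= v -> P u <= P v.
  by move=> /PB/andP[]; rewrite subr_ge0.
have P_ge0 y : 0 <= P y.
  have [/P0 ->//|/ltW x0y] := leP y x0.
  by rewrite -(P0 x0 (lexx _)) Pnd.
have P_le y : P y <= P h.
  by have [/Pnd//|/ltW/Ph ->] := leP y h.
pose c := P h / 2; pose f y := c - P y; pose df x := - 1 * g x.
have c0 : 0 <= c by rewrite divr_ge0.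
have fc y : `|f y| <= c.
  rewrite ler_norml /f; have := P_ge0 y; have := P_le y.
  by rewrite /c; lra.
have mf (D : set R) : measurable_fun D f.
  apply: measurable_funTS; apply: measurable_funB => //.
  by apply: nondecreasing_measurable => // u v _ _; exact: Pnd.
have Linf : (Linfty_norm G (EFin \o f) <= c%:E)%E.
  by apply/Linfty_norm_le => //; apply: aeW => y _; rewrite abse_EFin lee_fin.
have Edf : E df by have := il_scale hE (-1) Eg; rewrite /df.
have fdf : L1infty G E f df.
  split => //.
  - exact: le_lt_trans Linf (ltry _).
  - move=> a b _ _; apply: (@lipschitz_abs_continuous a b m) => // u v uv.
    have -> : f v - f u = - (P v - P u) by rewrite /f; ring.
    by have /andP[PB0 PBm] := PB _ _ uv; rewrite normrN ger0_norm.
  - apply: filterS dP; first exact: (ae_filter_ringOfSetsType mu).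
    move=> x dPx _; rewrite /df mulN1r -[- g x]add0r.
    exact: is_deriveB.
exists f, df; split => //.
have Ndf : N df <= 1.
  by rewrite /df (il_norm_scale hE)// normrN1 mul1r.
have Ndf0 := il_norm_ge0 hE Edf.
(* This is k / Gam times r / k, from ]0, h[, plus P h * h^-k / k, from ]h, +oo[, where the primitive
   has its final value P h = 2 c. *)
pose D := (r + P h * h `^ (- k)) / Gam.
suff DM : (D%:E <= Linfty_norm G (marchaud k n f))%E.
  apply: lt_le_trans DM.
  have /fineK fE : Linfty_norm G (EFin \o f) \is a fin_num.
    by rewrite ge0_fin_numE ?Linfty_norm_ge0// (le_lt_trans Linf)// ltry.
  set M := fine (Linfty_norm G (EFin \o f)) in fE.
  move: Linf; rewrite -fE -tauE lee_fin => Mc.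
  rewrite -!(EFinM, EFinB, EFinD) lte_fin.
  apply: (@le_lt_trans _ _ (2 * h `^ (- k) / Gam * c + (T / Gam - e))).
    apply: lerD.
      by rewrite ler_wpM2l// !mulr_ge0 ?powR_ge0 ?invr_ge0 ?(ltW Gam0).
    by rewrite ler_piMr// subr_ge0.
  have -> : D = 2 * h `^ (- k) / Gam * c + r / Gam.
    by rewrite /D /c; field; rewrite gt_eqF.
  rewrite ltrD2l -(@ltr_pM2r _ Gam)// mulrBl !divfK ?(gt_eqF Gam0)//.
  by rewrite [e * _]mulrC.
have Dle x : 0 < x < x0 -> (D%:E <= `|marchaud k n f x|)%E.
  move=> /andP[xpos xx0].
  have Gx : G x by apply: ge0_line_or_halfline => //; exact: ltW.
  have aefc : {ae mu, forall y, G y -> `|f y| <= c} by apply: aeW => y _.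
  have bnd := integral_increment_le hG hE hs k0 h0 fdf Gx c0 (fc x) aefc.
  rewrite -tauE -!(EFinM, EFinD) in bnd.
  rewrite (marchaudE hG (mf G) Gx k0 k1 n0); last exact: le_lt_trans bnd (ltry _).
  apply: le_trans (lee_abs _).
  (* f is nonincreasing and constant on [0, x0], so f x - f (t + x) >= f 0 - f t *)
  have -> : D = k / Gam * (k^-1 * r + P h * (h `^ (- k) / k)).
    by rewrite /D; field; rewrite !gt_eqF.
  rewrite EFinM lee_wpmul2l ?lee_fin//; first exact: divr_ge0 (ltW k0) (ltW Gam0).
  have mP (B : set R) : measurable_fun B (fun t => (P t * t `^ (- k - 1))%:E).
    apply/measurable_EFinP; apply: measurable_funM; last exact: measurable_funT_powR.
    by apply: measurable_funTS; apply: nondecreasing_measurable => // u v _ _; exact: Pnd.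
  apply: (@le_trans _ _ (\int[mu]_(t in pos) (P t * t `^ (- k - 1))%:E)%E); last first.
    apply: ge0_le_integral => //.
    - by move=> t _; rewrite lee_fin mulr_ge0 ?powR_ge0.
    - exact: mP.
    - apply/measurable_EFinP; apply: measurable_funM; last exact: measurable_funT_powR.
      exact: (measurable_funB (measurable_cst (f x)) (measurable_shift_pos hG (mf G) Gx)).
    - move=> t _; rewrite lee_fin ler_wpM2r ?powR_ge0//.
      have -> : f x - f (t + x) = P (t + x) - P x by rewrite /f; ring.
      rewrite (P0 x (ltW xx0)) subr0.
      by rewrite Pnd// lerDl ltW.
  rewrite (ge0_integral_split h0); [|exact: mP|]; last first.
    by move=> t _; rewrite lee_fin mulr_ge0 ?powR_ge0.
  rewrite EFinD leeD//.
    have -> : (\int[mu]_(t in `]0%R, h[) (P t * t `^ (- k - 1))%:E =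
        \int[mu]_(t in `]0%R, h[) ((t `^ (- k - 1))%:E * \int[mu]_(s in `]0%R, t[) (g s)%:E))%E.
      apply: eq_integral => t; rewrite inE/= in_itv/= => /andP[t0 _].
      by rewrite mulrC EFinM PE.
    rewrite integral_powR_primitive//; last exact: measurable_funTS mg.
    by rewrite EFinM lee_pmul2l ?lte_fin ?invr_gt0.
  have -> : (\int[mu]_(t in `]h, +oo[) (P t * t `^ (- k - 1))%:E =
      \int[mu]_(t in `]h, +oo[) ((P h)%:E * (t `^ (- k - 1))%:E))%E.
    apply: eq_integral => t; rewrite inE/= in_itv/= andbT => ht.
    by rewrite (Ph t (ltW ht)) EFinM.
  rewrite ge0_integralZl_EFin ?integral_powR_tail//.
  - by move=> t _; rewrite lee_fin powR_ge0.
  - by apply/measurable_EFinP; exact: measurable_funT_powR.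
(* A norm below [D] would bound the derivative below [D] almost everywhere, hence somewhere in ]0,
   x0[, against [Dle]. *)
rewrite leNgt; apply/negP => LD.
have /(Linfty_norm_le G (marchaud k n f) (Linfty_norm_ge0 _ _)) := lexx (Linfty_norm G (marchaud k n f)).
move=> /(ae_itv_witness x00)[x xx0].
have /andP[/ltW xpos _] := xx0.
move=> /(_ (ge0_line_or_halfline hG xpos)) /(le_trans (Dle x xx0)).
by rewrite leNgt LD.
Qed.

End sharpness.

Theorem corollary5 (R : realType) (G : set R)
    (hG : G = [set: R] \/ G = [set` `[0, +oo[])
    (k : R) (hk0 : 0 < k) (hk1 : k < 1)
    (n : nat) (hn : k < n%:R)
    (E : set (R -> R)) (N : (R -> R) -> R) (A : set R)
    (hE : ideal_lattice G E N)
    (hshift : semi_shift_invariant G E N)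
    (hA : is_support G E A)
    (hmem : assoc_space G E N A (cut_power k 1))
    (hlim : assoc_norm G E N (cut_power k h) @[h --> 0^'+] --> 0%E)
    (h : R) (hh : 0 < h) :
  (forall f df : R -> R, L1infty G E f df ->
     (Linfty_norm G (marchaud k n f) <=
        (2 * h `^ (- k) / Gamma (1 - k))%:E * Linfty_norm G (EFin \o f)
        + (assoc_norm G E N (tau k h) * ((Gamma (1 - k))^-1)%:E) * (N df)%:E)%E)
  /\
  (\forall e \near 0^'+, exists f df : R -> R, L1infty G E f df /\
     ((2 * h `^ (- k) / Gamma (1 - k))%:E * Linfty_norm G (EFin \o f)
        + (assoc_norm G E N (tau k h) * ((Gamma (1 - k))^-1)%:E - e%:E)
            * (N df)%:E
      < Linfty_norm G (marchaud k n f))%E).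
Proof.
have n0 : (0 < n)%N by rewrite -(ltr0n R); exact: lt_trans hn.
have [_ _ cut_fin] := hmem.
have tau_fin := assoc_norm_tau_lty h hG hE hshift hk0 cut_fin.
split; first by move=> f df; exact: marchaud_le.
have Gam0 := Gamma_1B_gt0 hk0 hk1.
have tau_pos := assoc_norm_tau_gt0 hG hE hA hk0 hh hmem.
have tau_num : assoc_norm G E N (tau k h) \is a fin_num.
  by rewrite ge0_fin_numE// ltW.
(* Sufficiently small means 0 < e <= T / Gamma (1 - k), with T the associated norm of [tau k h];
   positivity of T makes this a right neighbourhood of 0. *)
near=> e; apply: marchaud_sharp => //.
near: e; apply: nbhs_right_le; rewrite divr_gt0// fine_gt0// tau_pos.
Unshelve. all: by end_near. Qed.
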